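(* Let $G$ be a finite group and let $n$ be a positive divisor of $\exp(G)$ such that $\gcd(n,\exp(G)/n)=1$. Then for every $(H,hH^{[n]})\in\mathcal{D}^{C_n}_G$ (i.e. $H\le G$ and $h\in H$), the conductor $c^{G,n}_{H,h}$ of the primitive idempotent $e^{G,n}_{H,h}$ of $B^{C_n}_{\mathbb{Q}[\zeta]}(G)$ is $$c^{G,n}_{H,h}=[N_G(H,hH^{[n]}):H^{[n]}]\,[H^{[n]}:H']_0 .$$
   Context: $G$ is a finite group, $n$ a positive divisor of $\exp(G)$ (the exponent of $G$), $\zeta=e^{2\pi i/n}$, and $C_n=\langle\zeta\rangle\le\mathbb{C}^\times$. Notation: ${}^gH=gHg^{-1}$; for $\phi\in\mathrm{Hom}(H,C_n)$, ${}^g\phi\in\mathrm{Hom}({}^gH,C_n)$ is ${}^g\phi(x)=\phi(g^{-1}xg)$. $H'$ is the commutator subgroup. For a positive integer $m$, $m_0$ is the product of the distinct prime divisors of $m$. For a finite group $H$, $H^{[n]}$ is the smallest normal subgroup of $H$ such that $H/H^{[n]}$ is abelian with all elements of order dividing $n$; $H^{[n]}=\langle H',\{x^n : x\in H\}\rangle$. Fibered Burnside ring: let $\mathcal{M}^{C_n}_G$ be the set of pairs $(H,\phi)$ with $H\le G$, $\phi\in\mathrm{Hom}(H,C_n)$, on which $G$ acts by ${}^g(H,\phi)=({}^gH,{}^g\phi)$; $[H,\phi]_G$ denotes the orbit. $B^{C_n}(G)$ is the free abelian group on the set of orbits with multiplication $[H,\phi]_G[K,\psi]_G=\sum_{g\in[H\backslash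 G/K]}[H\cap{}^gK,\ \phi|_{H\cap{}^gK}\cdot({}^g\psi)|_{H\cap{}^gK}]_G$, where $[H\backslash G/K]$ is a set of double coset representatives. It is a commutative ring with identity $[G,1]_G$. For a commutative ring $R$, $B^{C_n}_R(G)=R\otimes B^{C_n}(G)$. $\mathcal{D}^{C_n}_G$ is the set of pairs $(H,hH^{[n]})$ with $H\le G$, $h\in H$, on which $G$ acts by conjugation; $[H,hH^{[n]}]_G$ is the orbit and $N_G(H,hH^{[n]})$ the stabilizer. For each such pair, the species $s^{G,n}_{H,h}$ is the ring homomorphism with $s^{G,n}_{H,h}([K,\phi]_G)=\sum_{gK\in G/K,\ H\le{}^gK}{}^g\phi(h)$, extended $\mathbb{Q}[\zeta]$-linearly to $B^{C_n}_{\mathbb{Q}[\zeta]}(G)$. The primitive idempotent $e^{G,n}_{H,h}\in B^{C_n}_{\mathbb{Q}[\zeta]}(G)$ is the unique element with $s^{G,n}_{K,k}(e^{G,n}_{H,h})=1$ if $[K,kK^{[n]}]_G=[H,hH^{[n]}]_G$ and $0$ otherwise, for all $(K,kK^{[n]})\in\mathcal{D}^{C_n}_G$. Its conductor $c^{G,n}_{H,h}$ is the least positive integer $t$ such that $t\,e^{G,n}_{H,h}\in B^{C_n}_{\mathbb{Z}[\zeta]}(G)$. *)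

(* Defs.v *)
From HB Require Import structures.
From mathcomp Require Import all_boot all_order all_algebra.
From mathcomp Require Import all_fingroup all_solvable all_field all_character.

Set Implicit Arguments.
Unset Strict Implicit.
Unset Printing Implicit Defensive.

Import Order.TTheory GRing.Theory Num.Theory.
Local Open Scope ring_scope.

(** m_0 *)
Definition radical (m : nat) : nat := (\prod_(p <- primes m) p)%N.

Section NResidual.
Variables (gT : finGroupType) (n : nat).
Implicit Types (H : {group gT}) (x y g : gT).

(** H^[n] *)
Definition nresidual (A : {set gT}) : {set gT} :=
  (<<A^`(1) :|: [set x ^+ n | x in A]>>)%g.
Canonical nresidual_group A := Eval hnf in [group of nresidual A].

Lemma nresidualJ (H : {group gT}) g : (nresidual (H :^ g) = nresidual H :^ g)%g.
Proof.
rewrite /nresidual -genJ conjUg -derJ; congr (<<_ :|: _>>)%g.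
apply/setP=> y; rewrite mem_conjg; apply/imsetP/imsetP=> -[x].
  rewrite mem_conjg => Hx ->; exists (x ^ g^-1)%g; rewrite // conjXg //.
by move=> Hx e; exists (x ^ g)%g; rewrite ?memJ_conjg // -conjXg -e conjgKV.
Qed.

Lemma nresidual_sub H : nresidual H \subset H.
Proof.
rewrite gen_subG subUset der_sub /=.
by apply/subsetP=> _ /imsetP[x Hx ->]; rewrite groupX.
Qed.

Lemma der_nresidual H : (H^`(1) \subset nresidual H)%g.
Proof. by rewrite (subset_trans _ (subset_gen _)) ?subsetUl. Qed.

Lemma nresidual_normal H : (nresidual H <| H)%g.
Proof. exact: sub_der1_normal (der_nresidual H) (nresidual_sub H). Qed.

Lemma mem_nresidualX H x : x \in H -> (x ^+ n)%g \in nresidual H.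
Proof. by move=> Hx; rewrite mem_gen // inE (imset_f (fun x => x ^+ n)%g) ?orbT. Qed.

Lemma nresidual_min H (N : {group gT}) :
  (N <| H)%g -> abelian (H / N)%g -> (exponent (H / N)%g %| n)%N ->
  nresidual H \subset N.
Proof.
move=> nNH abN /exponentP eN; rewrite gen_subG subUset.
rewrite der1_min ?normal_norm //=.
apply/subsetP=> _ /imsetP[x Hx ->]; have nx := subsetP (normal_norm nNH) x Hx.
by rewrite coset_idr ?groupX // morphX // eN ?mem_quotient.
Qed.

Lemma nresidual_quotient H :
  abelian (H / nresidual H)%g /\ (exponent (H / nresidual H)%g %| n)%N.
Proof.
split; first by rewrite sub_der1_abelian ?der_nresidual.
apply/exponentP=> _ /morphimP[x nx Hx ->].
by rewrite -morphX //= coset_id // mem_nresidualX.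
Qed.

End NResidual.

Section FiberedBurnside.

Variables (gT : finGroupType) (G : {group gT}) (n : nat) (zeta : algC).
Hypothesis zeta_prim : n.-primitive_root zeta.

Implicit Types (H K L : {group gT}) (h k g x y : gT).

(** C_n = <zeta>; any primitive n-th root of unity zeta is allowed *)
Definition fiber_seq : seq algC := [seq zeta ^+ i | i <- iota 0 n].
Definition fiber : finType := seq_sub fiber_seq.

Lemma mem_fiberP (z : algC) : reflect (z ^+ n = 1) (z \in fiber_seq).
Proof.
apply: (iffP mapP) => [[i _ ->] | /(prim_rootP zeta_prim)[i ->]].
  by rewrite exprAC (prim_expr_order zeta_prim) expr1n.
by exists (i : nat); rewrite // mem_iota /=.
Qed.

Fact fiber1_subproof : 1 \in fiber_seq.
Proof. by apply/mem_fiberP; rewrite expr1n. Qed.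
Definition fiber1 : fiber := SeqSub fiber1_subproof.

Fact fiberM_subproof (a b : fiber) : ssval a * ssval b \in fiber_seq.
Proof.
case: a b => [a /= /mem_fiberP aP] [b /= /mem_fiberP bP].
by apply/mem_fiberP; rewrite exprMn aP bP mulr1.
Qed.
Definition fiberM (a b : fiber) : fiber := SeqSub (fiberM_subproof a b).

(** Raw pairs (H, phi); a homomorphism H -> C_n is encoded by its extension
    by 1 to the whole of gT, so that distinct homomorphisms are distinct *)
Definition mpair : finType := ({group gT} * {ffun gT -> fiber})%type.

Definition is_hom (H : {set gT}) (phi : {ffun gT -> fiber}) : bool :=
  [forall x in H, forall y in H,
     ssval (phi (x * y)%g) == ssval (phi x) * ssval (phi y)]
  && [forall x, (x \notin H) ==> (phi x == fiber1)].

Definition mpairs : {set mpair} :=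
  [set p : mpair | (p.1 \subset G) && is_hom p.1 p.2].

(** MathComp actions are right actions: g acts as the inverse of g acts on the
    left, so orbits and stabilizers are unchanged *)
Definition mconj (p : mpair) g : mpair :=
  ((p.1 :^ g)%G, [ffun x => p.2 (x ^ g^-1)%g]).

Fact mconj1 : mconj^~ 1%g =1 id.
Proof.
case=> H f; congr (_, _) => /=; first by apply/val_inj; rewrite /= conjsg1.
by apply/ffunP=> x; rewrite ffunE invg1 conjg1.
Qed.

Fact mconjM (p : mpair) g h : mconj p (g * h)%g = mconj (mconj p g) h.
Proof.
congr (_, _) => /=.
  by apply/val_inj; rewrite /= conjsgM.
by apply/ffunP=> x; rewrite !ffunE invMg conjgM.
Qed.
Canonical mconj_action := TotalAction mconj1 mconjM.

Local Notation morbit p := (orbit mconj_action G p).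

Definition morbits : {set {set mpair}} := [set morbit p | p in mpairs].
Definition mclass : finType := {o : {set mpair} | o \in morbits}.

(** algC (x) B^{C_n}(G), the free algC-module on the orbits; the coefficient
    rings Z[zeta] and Q[zeta] are cut out below by fb_int and fb_rat *)
Definition fburnside : Type := {ffun mclass -> algC^o}.
HB.instance Definition _ := GRing.Lmodule.on fburnside.

(** [H, phi]_G for p = (H, phi) in mpairs *)
Definition bclass (p : mpair) : fburnside :=
  [ffun o : mclass => (val o == morbit p)%:R].

Fact orep_subproof (o : mclass) :
  exists p : mpair, (p \in mpairs) && (morbit p == val o).
Proof.
by case: o => o /= /imsetP[p Mp ->]; exists p; rewrite Mp eqxx.
Qed.
Definition orep (o : mclass) : mpair := xchoose (orep_subproof o).

Lemma orep_mpairs o : orep o \in mpairs.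
Proof. by case/andP: (xchooseP (orep_subproof o)). Qed.
Lemma orbit_orep o : morbit (orep o) = val o.
Proof. by case/andP: (xchooseP (orep_subproof o)) => _ /eqP. Qed.

Definition dcosets (H K : {set gT}) : {set {set gT}} :=
  [set (H :* g * K)%g | g in G].

(** (H cap gKg^-1, phi . g psi) for p = (H, phi), q = (K, psi) *)
Definition mcap (p q : mpair) g : mpair :=
  let L := (p.1 :&: q.1 :^ g^-1)%G in
  (L, [ffun x => if x \in L then fiberM (p.2 x) (q.2 (x ^ g)%g) else fiber1]).

Definition mmul (p q : mpair) : fburnside :=
  \sum_(D in dcosets p.1 q.1) bclass (mcap p q (repr D)).

Definition fbmul (x y : fburnside) : fburnside :=
  \sum_(o : mclass) \sum_(o' : mclass)
     (x o * y o' : algC) *: mmul (orep o) (orep o').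

Definition mtriv : mpair := (G, [ffun=> fiber1]).
Definition fbone : fburnside := bclass mtriv.

(** s_{H,h}([K, phi]_G) for p = (K, phi), gK being the coset C *)
Definition mark H h (p : mpair) : algC :=
  \sum_(C in lcosets p.1 G | H \subset (p.1 :^ (repr C)^-1)%g)
    ssval (p.2 (h ^ repr C)%g).

Definition species H h (x : fburnside) : algC :=
  \sum_(o : mclass) (x o : algC) * mark H h (orep o).

Lemma fiber_neq0 (a : fiber) : ssval a != 0.
Proof.
case: a => a /= /mem_fiberP aP; apply/eqP=> a0; move: aP.
rewrite a0 expr0n; have := prim_order_gt0 zeta_prim.
by case: (n) => // m _ /eqP; rewrite eq_sym oner_eq0.
Qed.

Lemma hom_out (A : {set gT}) phi x : is_hom A phi -> x \notin A -> phi x = fiber1.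
Proof. by case/andP=> _ /forallP/(_ x)/implyP h /h/eqP. Qed.

Lemma homM (A : {set gT}) phi x y : is_hom A phi -> x \in A -> y \in A ->
  ssval (phi (x * y)%g) = ssval (phi x) * ssval (phi y).
Proof. by case/andP=> /forall_inP h _ /h/forall_inP h' /h'/eqP. Qed.

Lemma hom1 H phi : is_hom H phi -> ssval (phi 1%g) = 1.
Proof.
move=> hp; apply: (mulfI (fiber_neq0 (phi 1%g))).
by rewrite -(homM hp) ?group1 // mulg1 mulr1.
Qed.

Lemma homJ H phi x y : is_hom H phi -> x \in H -> y \in H -> phi (x ^ y)%g = phi x.
Proof.
move=> hp Hx Hy; apply/val_inj/(mulfI (fiber_neq0 (phi y))).
by rewrite /= -!(homM hp) ?groupJ // -conjgC !(homM hp) // mulrC.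
Qed.

Lemma homV H phi x : is_hom H phi -> x \in H ->
  ssval (phi x^-1%g) = (ssval (phi x))^-1.
Proof.
move=> hp Hx; apply: (mulfI (fiber_neq0 (phi x))).
by rewrite -(homM hp) ?groupV // mulgV (hom1 hp) mulfV ?fiber_neq0.
Qed.

Lemma homX H phi x i : is_hom H phi -> x \in H ->
  ssval (phi (x ^+ i)%g) = ssval (phi x) ^+ i.
Proof.
move=> hp Hx; elim: i => [|i IH]; first by rewrite expg0 (hom1 hp).
by rewrite expgS exprS (homM hp) ?groupX // IH.
Qed.

Lemma hom_nresidual H phi x : is_hom H phi -> x \in nresidual n H -> phi x = fiber1.
Proof.
move=> hp; pose N := [set y in H | phi y == fiber1].
have gN : group_set N.
  apply/group_setP; split.
    by rewrite inE group1 -val_eqE /= (hom1 hp) /=.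
  move=> y z; rewrite !inE => /andP[Hy /eqP ey] /andP[Hz /eqP ez].
  by rewrite groupM // -val_eqE /= (homM hp) // ey ez mulr1 /=.
suff /subsetP sN : nresidual n H \subset Group gN.
  by move=> /sN; rewrite inE => /andP[_ /eqP].
rewrite gen_subG subUset; apply/andP; split.
  rewrite gen_subG; apply/subsetP=> _ /imset2P[y z Hy Hz ->].
  rewrite inE groupR // -val_eqE /= commgEl (homM hp) ?groupV ?groupJ //.
  by rewrite (homJ hp) // (homV hp) // mulVf ?fiber_neq0.
apply/subsetP=> _ /imsetP[y Hy ->]; rewrite inE groupX // -val_eqE /=.
by rewrite (homX n hp) //; apply/eqP/mem_fiberP/ssvalP.
Qed.

Lemma mconj_mpairs p g : p \in mpairs -> g \in G -> mconj p g \in mpairs.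
Proof.
case: p => K f; rewrite !inE /= => /andP[sK hf] Gg.
rewrite -{1}(conjGid Gg) conjSg sK /=; apply/andP; split.
  apply/forall_inP=> x; rewrite mem_conjg => Kx.
  apply/forall_inP=> y; rewrite mem_conjg => Ky.
  by rewrite !ffunE conjMg (homM hf).
apply/forallP=> x; apply/implyP; rewrite mem_conjg ffunE => Kx.
by rewrite (hom_out hf).
Qed.

Lemma mcap_mpairs p q g : p \in mpairs -> q \in mpairs -> mcap p q g \in mpairs.
Proof.
case: p => K f; case: q => L f'; rewrite !inE /= => /andP[sK hf] /andP[sL hf'].
rewrite (subset_trans (subsetIl _ _) sK) /=; apply/andP; split.
  apply/forall_inP=> x Ix; apply/forall_inP=> y Iy; rewrite !ffunE groupM // Ix Iy /=.
  move: Ix Iy; rewrite !in_setI !mem_conjg !invgK => /andP[Kx Lx] /andP[Ky Ly].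
  by rewrite (homM hf) // conjMg (homM hf') // mulrACA.
by apply/forallP=> x; apply/implyP; rewrite ffunE => /negbTE ->.
Qed.

Lemma mtriv_mpairs : mtriv \in mpairs.
Proof.
rewrite inE subxx /=; apply/andP; split.
  apply/forall_inP=> x _; apply/forall_inP=> y _; rewrite !ffunE /= mulr1 //.
by apply/forallP=> x; rewrite ffunE eqxx implybT.
Qed.

Definition fixv H h (p : mpair) x : algC :=
  if H \subset (p.1 :^ x^-1)%g then ssval (p.2 (h ^ x)%g) else 0.

Lemma fixvMr H h p x k : p \in mpairs -> h \in H -> k \in p.1 ->
  fixv H h p (x * k)%g = fixv H h p x.
Proof.
case: p => K f; rewrite inE /= => /andP[_ hf] Hh Kk.
rewrite /fixv /= invMg conjsgM (conjGid (groupVr Kk)).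
case: ifP => // /subsetP/(_ h Hh); rewrite mem_conjg invgK => Khx.
by rewrite conjgM (homJ hf).
Qed.

Lemma mark_sumE H h p : p \in mpairs -> h \in H ->
  #|p.1|%:R * mark H h p = \sum_(x in G) fixv H h p x.
Proof.
move=> Mp Hh; have sK : p.1 \subset G by move: Mp; rewrite inE => /andP[].
rewrite (partition_big (fun x => x *: p.1)%g (mem (lcosets p.1 G))) /=; last first.
  by move=> x Gx; rewrite mem_lcosets (subsetP (mulG_subl _ _)).
rewrite /mark big_mkcondr big_distrr /=; apply: eq_bigr => C CG.
have /lcosetsP[g Gg eC] := CG.
have rC : repr C \in C by rewrite eC (mem_repr g) ?lcoset_refl.
have eC' : C = (repr C *: p.1)%g.
  by rewrite {1}eC; apply/lcoset_eqP; rewrite lcoset_sym -eC.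
have sCG : C \subset G by rewrite eC mul_subG ?sub1set.
transitivity (\sum_(x in C) fixv H h p (repr C)).
  have cC : #|C| = #|p.1| by rewrite eC card_lcoset.
  by rewrite sumr_const cC mulr_natl.
symmetry; apply: eq_big => [x | x /andP[_ /eqP ex]].
  apply/andP/idP => [[Gx /eqP <-] | Cx]; first exact: lcoset_refl.
  rewrite (subsetP sCG) // eC' eq_sym; split=> //.
  by apply/eqP/lcoset_eqP; rewrite lcoset_sym -eC'.
have /lcosetP[k Kk ->] : x \in (repr C *: p.1)%g by rewrite -eC' -ex lcoset_refl.
by rewrite fixvMr.
Qed.

Lemma cardmp_neq0 (p : mpair) : #|p.1|%:R != 0 :> algC.
Proof. by rewrite pnatr_eq0 -lt0n cardG_gt0. Qed.

Lemma fixv_mconj H h p g x : fixv H h (mconj p g) x = fixv H h p (x * g^-1)%g.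
Proof.
rewrite /fixv /= ffunE -conjgM invMg invgK conjsgM; congr (if _ then _ else _).
Qed.

Lemma mark_mconj H h p g : p \in mpairs -> h \in H -> g \in G ->
  mark H h (mconj p g) = mark H h p.
Proof.
move=> Mp Hh Gg; apply: (mulfI (cardmp_neq0 p)).
rewrite -{1}(cardJg p.1 g) -[(p.1 :^ g)%g]/(gval (mconj p g).1).
rewrite !mark_sumE ?mconj_mpairs // (reindex_inj (mulIg g)) /=.
by apply: eq_big => [x | x _]; rewrite ?groupMr // fixv_mconj mulgK.
Qed.

Lemma species_bclass H h p : p \in mpairs -> h \in H ->
  species H h (bclass p) = mark H h p.
Proof.
move=> Mp Hh; have Op : morbit p \in morbits by apply: imset_f.
pose o : mclass := Sub (morbit p) Op.
rewrite /species (bigD1 o) //= big1 ?addr0 => [|o' no]; last first.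
  rewrite ffunE; case: eqP => [e|]; last by rewrite mul0r.
  by case/eqP: no; apply/val_inj.
rewrite ffunE eqxx mul1r.
have /orbitP[g Gg <-] : orep o \in morbit p.
  by rewrite -[morbit p]/(val o) -orbit_orep orbit_refl.
exact: mark_mconj.
Qed.

Lemma speciesZD H h (a : algC) (x y : fburnside) :
  species H h (a *: x + y) = a * species H h x + species H h y.
Proof.
rewrite /species big_distrr -big_split /=; apply: eq_bigr => o _.
by rewrite !ffunE mulrDl mulrA.
Qed.

Lemma species0 H h : species H h 0 = 0.
Proof. by rewrite /species big1 // => o _; rewrite ffunE mul0r. Qed.

Lemma speciesD H h (x y : fburnside) : species H h (x + y) = species H h x + species H h y.
Proof. by rewrite -{1}[x]scale1r speciesZD mul1r. Qed.

Lemma speciesZ H h (a : algC) (x : fburnside) : species H h (a *: x) = a * species H h x.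
Proof. by rewrite -{1}[a *: x]addr0 speciesZD species0 addr0. Qed.

Lemma species_sum H h (I : Type) (r : seq I) (P : pred I) (F : I -> fburnside) :
  species H h (\sum_(i <- r | P i) F i) = \sum_(i <- r | P i) species H h (F i).
Proof.
exact: (big_morph (species H h) (speciesD H h) (species0 H h)).
Qed.

Lemma fixv_mcap H h p q g x : h \in H ->
  fixv H h (mcap p q g) x = fixv H h p x * fixv H h q (x * g)%g.
Proof.
move=> Hh; rewrite /fixv /= conjIg subsetI -conjsgM -invMg.
case: ifP => [/andP[sK sL] | /negbT].
  rewrite sK sL ffunE; have -> : (h ^ x)%g \in (p.1 :&: q.1 :^ g^-1)%G.
    rewrite inE -{1}[x]invgK -mem_conjg (subsetP sK) //=.
    rewrite mem_conjg invgK -conjgM -[(x * g)%g]invgK -mem_conjg.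
    exact: subsetP sL _ Hh.
  by rewrite /= conjgM.
by case: ifP; case: ifP => //= _ _ _; rewrite ?mul0r ?mulr0.
Qed.

Lemma card_dcoset (K L : {group gT}) g :
  (#|K| * #|L| = #|(K :* g * L)%g| * #|(K :&: L :^ g^-1)%g|)%N.
Proof.
rewrite -{1}(cardJg L g^-1) mul_cardG; congr (_ * _)%N.
rewrite -(card_rcoset (K * L :^ g^-1)%g g); congr #|pred_of_set _|.
by rewrite conjsgE invgK -!mulgA mulg_set1 mulVg mulg1.
Qed.

Lemma species_mmul H h p q : p \in mpairs -> q \in mpairs -> h \in H ->
  species H h (mmul p q) = mark H h p * mark H h q.
Proof.
move=> Mp Mq Hh; apply: (mulfI (cardmp_neq0 q)); apply: (mulfI (cardmp_neq0 p)).
rewrite [RHS]mulrA [RHS]mulrACA !mark_sumE // mulrA -natrM.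
rewrite /mmul species_sum big_distrr /=.
pose F g := \sum_(x in G) fixv H h p x * fixv H h q (x * g)%g.
transitivity (\sum_(g in G) F g); last first.
  rewrite exchange_big /= big_distrl /=; apply: eq_bigr => x Gx.
  rewrite big_distrr /= [in RHS](reindex_inj (mulgI x)) /=.
  by apply: eq_bigl => g; rewrite groupMl.
rewrite (partition_big (fun g => p.1 :* g * q.1)%g (mem (dcosets p.1 q.1))) /=; last first.
  by move=> g Gg; apply: imset_f.
have sK : p.1 \subset G by move: Mp; rewrite inE => /andP[].
have sL : q.1 \subset G by move: Mq; rewrite inE => /andP[].
apply: eq_bigr => D /imsetP[g Gg eD].
have Dg x : x \in D -> exists k l, [/\ k \in p.1, l \in q.1 & x = (k * g * l)%g].
  rewrite eD => /mulsgP[y l /rcosetP[k Kk ->] Ll ->]; by exists k, l.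
have xKxL x : x \in (p.1 :* x * q.1)%g.
  by rewrite -{1}[x]mulg1 mem_mulg ?rcoset_refl.
have gD : g \in D.
  by rewrite eD.
have rD : repr D \in D by apply: mem_repr gD.
have eF x : x \in D -> F x = F g.
  move=> /Dg[k [l [Kk Ll ->]]]; rewrite /F (reindex_inj (mulIg k^-1%g)) /=.
  apply: eq_big => [y | y Gy]; first by rewrite groupMr // groupV (subsetP sK).
  by rewrite fixvMr ?groupV // !mulgA mulgKV fixvMr.
have eDx x : x \in D -> (p.1 :* x * q.1)%g = D.
  move=> /Dg[k [l [Kk Ll ->]]]; rewrite eD.
  by rewrite rcosetM rcosetM (rcoset_id Kk) -mulgA lcoset_id.
rewrite species_bclass ?mcap_mpairs //.
rewrite (card_dcoset _ _ (repr D)) eDx //.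
rewrite natrM -mulrA.
rewrite (mark_sumE (p := mcap p q (repr D))) ?mcap_mpairs //.
rewrite (eq_bigr _ (fun x _ => fixv_mcap p q (repr D) x Hh)).
rewrite -/(F (repr D)) eF // mulr_natl -sumr_const.
symmetry; apply: eq_big => [x | x /andP[_ /eqP ex]]; last first.
  by rewrite eF // -ex.
apply/andP/idP => [[Gx /eqP <-] | Dx].
  exact: xKxL.
split; last by rewrite eDx.
move/Dg: Dx => [k [l [Kk Ll ->]]].
by rewrite !groupM // ?(subsetP sK k Kk) ?(subsetP sL l Ll).
Qed.

Lemma hom_sum0 H (chi : gT -> algC) y :
    {in H &, forall x z, chi (x * z)%g = chi x * chi z} ->
  y \in H -> chi y != 1 -> \sum_(x in H) chi x = 0.
Proof.
move=> chiM Hy chiy; set S := \sum_(x in H) _.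
have eS : S = chi y * S.
  rewrite big_distrr /S /= (reindex_inj (mulgI y)) /=.
  by apply: eq_big => [x | x Hx]; [rewrite groupMl | rewrite chiM // -(groupMl x Hy)].
apply/eqP; move/eqP: eS; rewrite -subr_eq0 -{1}[S]mul1r -mulrBl mulf_eq0.
by rewrite subr_eq0 eq_sym (negbTE chiy).
Qed.

Lemma hom_orth K f f' : is_hom K f -> is_hom K f' ->
  \sum_(k in K) (ssval (f k))^-1 * ssval (f' k) = #|K|%:R * (f == f')%:R.
Proof.
move=> hf hf'; have [<- | nff'] := eqVneq f f'.
  rewrite mulr1 -sumr_const; apply: eq_bigr => k _; exact/mulVf/fiber_neq0.
rewrite mulr0; have /existsP[y ny] : [exists y, f y != f' y].
  apply: contraR nff' => /existsPn ne; apply/eqP/ffunP=> y.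
  by apply/eqP; rewrite -[_ == _]negbK ne.
have Ky : y \in K.
  by apply: contraR ny => nKy; rewrite (hom_out hf nKy) (hom_out hf' nKy).
apply: (@hom_sum0 K (fun k => (ssval (f k))^-1 * ssval (f' k)) y) => //.
  by move=> x z Kx Kz /=; rewrite (homM hf) // (homM hf') // invfM mulrACA.
apply: contra ny => /eqP e1; rewrite -val_eqE /= -[X in X == _]mulr1 -e1.
by rewrite mulrA mulfV ?fiber_neq0 // mul1r.
Qed.

Lemma mark_orth p q : p \in mpairs -> q \in mpairs -> (#|q.1| <= #|p.1|)%N ->
  #|q.1|%:R * (\sum_(k in p.1) (ssval (p.2 k))^-1 * mark p.1 k q)
    = #|p.1|%:R * #|[set g in G | mconj q g^-1 == p]|%:R.
Proof.
move=> Mp Mq le_qp; have [sK hf] : p.1 \subset G /\ is_hom p.1 p.2.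
  by move: Mp; rewrite inE => /andP[].
transitivity (\sum_(g in G) \sum_(k in p.1) (ssval (p.2 k))^-1 * fixv p.1 k q g).
  rewrite exchange_big big_distrr /=; apply: eq_bigr => k Kk.
  by rewrite mulrCA mark_sumE // big_distrr.
rewrite -sum1dep_card natr_sum big_mkcondr big_distrr /=; apply: eq_bigr => g Gg.
have Mqg : mconj q g^-1 \in mpairs by rewrite mconj_mpairs ?groupV.
have hqg : is_hom (q.1 :^ g^-1)%G (mconj q g^-1).2.
  by move: Mqg; rewrite inE => /andP[].
have [sKq | nsKq] := boolP (p.1 \subset (q.1 :^ g^-1)%g); last first.
  rewrite big1 => [|k Kk]; last by rewrite /fixv (negbTE nsKq) mulr0.
  case: eqP => [e|]; last by rewrite mulr0.
  by case/negP: nsKq; rewrite -e.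
have eK : p.1 = (q.1 :^ g^-1)%G.
  by apply/val_inj/eqP; rewrite eqEcard sKq cardJg.
rewrite -eK in hqg.
have -> : (mconj q g^-1 == p) = (p.2 == (mconj q g^-1).2).
  rewrite -pair_eqE /pair_eq /= [RHS]eq_sym.
  by rewrite (_ : (_ == p.1) = true) //; apply/eqP.
transitivity (#|p.1|%:R * (p.2 == (mconj q g^-1).2)%:R : algC); last by case: (_ == _).
rewrite -hom_orth //; apply: eq_bigr => k Kk; congr (_ * _).
by rewrite /fixv sKq /= ffunE invgK.
Qed.

Lemma species_inj0 (x : fburnside) :
    (forall H h, H \subset G -> h \in H -> species H h x = 0) -> x = 0.
Proof.
move=> sp0; apply/ffunP=> o0; rewrite [RHS]ffunE; apply/eqP/negPn/negP=> nz0.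
pose P (o : mclass) := x o != 0.
case: (@arg_maxnP _ o0 P (fun o => #|(orep o).1|) nz0) => o nzo max_o.
set p := orep o in max_o; have Mp : p \in mpairs by apply: orep_mpairs.
have sK : p.1 \subset G by move: Mp; rewrite inE => /andP[].
have : \sum_(k in p.1) (ssval (p.2 k))^-1 * species p.1 k x = 0.
  by rewrite big1 // => k Kk; rewrite sp0 ?mulr0.
rewrite /species; under eq_bigr => k _ do rewrite big_distrr.
rewrite exchange_big /= (bigD1 o) //= [X in _ + X]big1 ?addr0 => [|o' no']; last first.
  have [x0 | nx0] := eqVneq (x o' : algC) 0.
    by rewrite big1 // => k _; rewrite x0 mul0r mulr0.
  under eq_bigr => k _ do rewrite mulrCA.
  rewrite -big_distrr /= (_ : \sum_(k in p.1) _ = 0) ?mulr0 //.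
  apply: (mulfI (cardmp_neq0 (orep o'))).
  rewrite mulr0 (mark_orth Mp (orep_mpairs o') (max_o o' nx0)) (_ : [set g in G | _] = set0).
    by rewrite cards0 mulr0.
  apply/setP=> g; rewrite !inE; apply/negP=> /andP[Gg /eqP e].
  case/eqP: no'; apply/val_inj; rewrite /= -!orbit_orep -/p -e.
  by apply/orbit_eqP; rewrite orbit_sym; apply/orbitP; exists g^-1%g; rewrite ?groupV.
under eq_bigr => k _ do rewrite mulrCA.
rewrite -big_distrr /= => S0.
have {}S0 : \sum_(k in p.1) (ssval (p.2 k))^-1 * mark p.1 k p = 0.
  by apply: (mulfI nzo); rewrite mulr0.
move/(congr1 ( *%R #|p.1|%:R)): S0; rewrite mulr0 mark_orth // => /eqP.
rewrite mulf_eq0 (negbTE (cardmp_neq0 p)) pnatr_eq0 cards_eq0 => /eqP/setP/(_ 1%g).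
by rewrite !inE group1 /= invg1 [mconj p 1%g]mconj1 eqxx.
Qed.

Lemma species_inj (x y : fburnside) :
    (forall H h, H \subset G -> h \in H -> species H h x = species H h y) -> x = y.
Proof.
move=> e; apply/eqP; rewrite -subr_eq0; apply/eqP/species_inj0=> H h sH Hh.
by rewrite addrC -scaleN1r speciesZD mulN1r e // addNr.
Qed.

Lemma species_fbmul H h (x y : fburnside) : h \in H ->
  species H h (fbmul x y) = species H h x * species H h y.
Proof.
move=> Hh; rewrite /fbmul species_sum big_distrl /=; apply: eq_bigr => o _.
rewrite species_sum big_distrr /=; apply: eq_bigr => o' _.
by rewrite speciesZ species_mmul ?orep_mpairs // mulrACA.
Qed.

Lemma species_fbone H h : H \subset G -> h \in H -> species H h fbone = 1.
Proof.
move=> sH Hh; rewrite species_bclass ?mtriv_mpairs //.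
apply: (mulfI (cardmp_neq0 mtriv)); rewrite mark_sumE ?mtriv_mpairs //= mulr1.
rewrite -sumr_const; apply: eq_bigr => x Gx.
by rewrite /fixv /= conjGid ?groupV // sH ffunE.
Qed.

Fact fbmulA : associative fbmul.
Proof. by move=> x y z; apply: species_inj=> H h sH Hh; rewrite !species_fbmul // mulrA. Qed.
Fact fbmulC : commutative fbmul.
Proof. by move=> x y; apply: species_inj=> H h sH Hh; rewrite !species_fbmul // mulrC. Qed.
Fact fbmul1 : left_id fbone fbmul.
Proof.
by move=> x; apply: species_inj=> H h sH Hh; rewrite species_fbmul // species_fbone // mul1r.
Qed.
Fact fbmulD : left_distributive fbmul +%R.
Proof.
move=> x y z; apply: species_inj=> H h sH Hh.
by rewrite speciesD !species_fbmul // speciesD mulrDl.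
Qed.
Fact fbone_neq0 : fbone != 0.
Proof.
apply/eqP=> e; have := species_fbone (sub1G G) (group1 _).
by rewrite e species0 => /eqP; rewrite eq_sym oner_eq0.
Qed.

HB.instance Definition _ := GRing.Zmodule_isComNzRing.Build fburnside
  fbmulA fbmulC fbmul1 fbmulD fbone_neq0.

Lemma bclassM p q : p \in mpairs -> q \in mpairs -> bclass p * bclass q = mmul p q.
Proof.
move=> Mp Mq; apply: species_inj=> H h sH Hh.
by rewrite [LHS]species_fbmul // !species_bclass // species_mmul.
Qed.

Lemma species_is_monoid_morphism H h : H \subset G -> h \in H ->
  monoid_morphism (species H h).
Proof.
move=> sH Hh; split=> [|x y]; first exact: species_fbone.
exact: species_fbmul.
Qed.


(** B_{Z[zeta]} and B_{Q[zeta]} inside algC (x) B: the elements whose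
    coefficients lie in Z[zeta], resp. Q[zeta] *)
Definition fb_int : {pred fburnside} :=
  [pred x : fburnside | [forall o, (x o : algC) \in Cint_span fiber_seq]].
Definition fb_rat : {pred fburnside} :=
  [pred x : fburnside | [forall o, (x o : algC) \in Crat_span fiber_seq]].

Lemma fb_ratD (x y : fburnside) : x \in fb_rat -> y \in fb_rat -> x + y \in fb_rat.
Proof.
move=> /forallP Qx /forallP Qy; apply/forallP=> o.
by rewrite ffunE; apply: rpredD.
Qed.

Lemma fb_rat0 : 0 \in fb_rat.
Proof. by apply/forallP=> o; rewrite ffunE; apply: rpred0. Qed.

Lemma fb_ratZ (a : algC) (x : fburnside) : a \in Crat -> x \in fb_rat -> a *: x \in fb_rat.
Proof.
move=> Qa /forallP Qx; apply/forallP=> o; rewrite ffunE.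
exact: Crat_spanM.
Qed.

Lemma fb_rat_bclass (z : algC) p : z \in fiber_seq -> z *: bclass p \in fb_rat.
Proof.
move=> Fz; apply/forallP=> o; rewrite !ffunE /=.
have Sz := mem_Crat_span Fz; case: eqP => _.
  by rewrite [_ *: _]mulr1.
by rewrite [_ *: _]mulr0; apply: rpred0.
Qed.

Lemma fb_rat_sum (I : finType) (P : pred I) (F : I -> fburnside) :
  (forall i, P i -> F i \in fb_rat) -> \sum_(i | P i) F i \in fb_rat.
Proof.
by move=> QF; elim/big_ind: _ => //; [apply: fb_rat0 | apply: fb_ratD].
Qed.

Lemma Crat_span_denom s z :
  z \in Crat_span s -> exists2 t, (0 < t)%N & z *+ t \in Cint_span s.
Proof.
case/Crat_spanP=> a ->; pose t := (\prod_i `|denq (a i)|)%N.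
exists t; first by rewrite prodn_gt0 // => i; rewrite absz_gt0 denq_neq0.
rewrite -sumrMnl; apply: rpred_sum => i _.
rewrite /t (bigD1 i) //= mulrnA; apply: rpredMn.
rewrite -mulrnAl -[_ *+ _]mulr_natr pmulrn absz_denq -ratr_int -rmorphM.
rewrite -numqE /= ratr_int mulrzl; apply: rpredMz.
by apply: mem_Cint_span; apply: mem_nth.
Qed.

Lemma fb_rat_denom (x : fburnside) : x \in fb_rat ->
  exists t, (0 < t)%N && (x *+ t \in fb_int).
Proof.
move=> /forallP Qx.
have /fin_all_exists[t tP] o : exists t : nat,
  (0 < t)%N && ((x o : algC) *+ t \in Cint_span fiber_seq).
  by have [t t0 St] := Crat_span_denom (Qx o); exists t; rewrite t0.
exists (\prod_o t o)%N; rewrite prodn_gt0 => [|o]; last by case/andP: (tP o).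
apply/forallP=> o; rewrite ffunMnE (bigD1 o) //= mulrnA; apply: rpredMn.
by case/andP: (tP o).
Qed.

(** Raw pairs; those of D_G^{C_n} are the dpt H h with H <= G and h in H *)
Definition dpair : finType := ({group gT} * {set gT})%type.
Definition dconj (q : dpair) g : dpair := ((q.1 :^ g)%G, (q.2 :^ g)%g).

Fact dconj1 : dconj^~ 1%g =1 id.
Proof.
by case=> H A; congr (_, _); rewrite /= ?conjsg1 //; apply/val_inj; rewrite /= conjsg1.
Qed.
Fact dconjM (q : dpair) g h : dconj q (g * h)%g = dconj (dconj q g) h.
Proof.
by congr (_, _); rewrite /= ?conjsgM //; apply/val_inj; rewrite /= conjsgM.
Qed.
Canonical dconj_action := TotalAction dconj1 dconjM.

Definition dpt H h : dpair := (H, h *: nresidual n H)%g.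
Definition dorbit H h : {set dpair} := orbit dconj_action G (dpt H h).
Definition dstab H h : {set gT} := 'C_G[dpt H h | dconj_action]%g.

Lemma dstabE H h : dstab H h = ('N_G(H) :&: 'N(h *: nresidual n H))%g.
Proof.
apply/setP=> g; rewrite in_setI [RHS]in_setI [X in _ = X && _]in_setI -andbA; congr (_ && _).
apply/astab1P/andP=> [[] /(congr1 val)/= eH eh | [nH nA]].
  by split; apply/normP.
by congr (_, _); [apply/val_inj | ]; apply/normP.
Qed.

Definition is_primitive_idempotent H h (e : fburnside) : bool :=
  (e \in fb_rat) &&
  [forall K : {group gT}, forall k : gT, (K \subset G) && (k \in K) ==>
     (species K k e == (dorbit K k == dorbit H h)%:R)].

Lemma primitive_idempotent_uniq H h e e' :
  is_primitive_idempotent H h e -> is_primitive_idempotent H h e' -> e = e'.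
Proof.
case/andP=> _ /forallP ep /andP[_ /forallP ep'].
apply: species_inj=> K k sK Kk.
move: (ep K) (ep' K) => /forallP/(_ k) + /forallP/(_ k).
by rewrite sK Kk => /eqP-> /eqP->.
Qed.

Lemma primitive_idempotent_idem H h e :
  is_primitive_idempotent H h e -> e * e = e.
Proof.
case/andP=> _ /forallP ep; apply: species_inj=> K k sK Kk.
rewrite [LHS]species_fbmul //; have /forallP/(_ k) := ep K.
by rewrite sK Kk /= => /eqP->; rewrite -natrM mulnb andbb.
Qed.

Lemma nresidualS (A B : {set gT}) : A \subset B -> nresidual n A \subset nresidual n B.
Proof. by move=> sAB; rewrite genS // setUSS ?imsetS ?commgSS. Qed.

Lemma dorbitP K k H h : reflect
  (exists g, [/\ g \in G, K = (H :^ g)%G & (k *: nresidual n K = (h *: nresidual n H) :^ g)%g])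
  (dorbit K k == dorbit H h).
Proof.
apply: (iffP eqP) => [/orbit_eqP/orbitP[g Gg [<- eA]] | [g [Gg -> eA]]].
  by exists g; split=> //; rewrite -eA.
by apply/orbit_eqP/orbitP; exists g => //; congr (_, _).
Qed.

Lemma dorbit_card K k H h : dorbit K k = dorbit H h -> #|K| = #|H|.
Proof. by move/eqP/dorbitP=> [g [_ -> _]]; rewrite cardJg. Qed.

Lemma species_dorbit K k H h (x : fburnside) : k \in K -> h \in H ->
  dorbit K k = dorbit H h -> species K k x = species H h x.
Proof.
move=> Kk Hh /eqP/dorbitP[g [Gg eK eA]].
apply: eq_bigr => o _; congr (_ * _); apply: (mulfI (cardmp_neq0 (orep o))).
have Mp := orep_mpairs o; move: (orep o) Mp => p Mp.
rewrite !mark_sumE // [RHS](reindex_inj (mulgI g)) /=.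
apply: eq_big => [x' | y Gy]; first by rewrite groupMl.
rewrite /fixv; have -> : (K \subset p.1 :^ y^-1)%g = (H \subset p.1 :^ (g * y)^-1)%g.
  by rewrite eK /= invMg conjsgM -[RHS]sub_conjg.
case: ifP => // sHp.
have : k \in (k *: nresidual n K)%g by apply: lcoset_refl.
rewrite eA mem_conjg => /lcosetP[r Rr /(canRL (conjgKV g)) ->].
have Rr' : (r ^ (g * y))%g \in nresidual n p.1.
  have: (r ^ (g * y))%g \in (nresidual n H :^ (g * y))%g by rewrite memJ_conjg.
  by rewrite -nresidualJ; apply/subsetP/nresidualS; rewrite sub_conjg.
have hf : is_hom p.1 p.2 by move: Mp; rewrite inE => /andP[].
rewrite -conjgM conjMg (homM hf) ?(hom_nresidual hf Rr') ?mulr1 //.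
  by rewrite -mem_conjgV (subsetP sHp).
by rewrite (subsetP (nresidual_sub n p.1)).
Qed.

Lemma hom_sep H x : x \in H -> x \notin nresidual n H ->
  exists2 f, is_hom H f & f x != fiber1.
Proof.
move=> Hx nRx; have nRH : {subset H <= 'N(nresidual n H)%g}.
  exact/subsetP/normal_norm/nresidual_normal.
set Q := (H / nresidual n H)%g; have [abQ eQ] := nresidual_quotient n H.
have Qc y : y \in H -> coset (nresidual n H) y \in Q by move/mem_quotient; apply.
have [i Ki] : exists i, coset (nresidual n H) x \notin cfker 'chi[Q]_i.
  apply/existsP; apply: contraR nRx => /existsPn nK.
  rewrite coset_idr ?nRH //; apply/set1P; rewrite -[[set 1%g]](TI_cfker_irr Q).
  by apply/bigcapP=> i _; rewrite -[_ \in _]negbK nK.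
have Li : 'chi[Q]_i \is a linear_char by apply/char_abelianP.
pose chi y := 'chi_i (coset (nresidual n H) y).
have chin y : y \in H -> chi y \in fiber_seq.
  move=> Hy; apply/mem_fiberP; rewrite -lin_charX ?Qc //.
  by rewrite (exponentP eQ) ?Qc // lin_char1.
pose f := [ffun y => if y \in H then insubd fiber1 (chi y) else fiber1].
have fE y : y \in H -> ssval (f y) = chi y.
  move=> Hy; rewrite ffunE Hy -[ssval _]/(val _) val_insubd.
  by rewrite (chin y Hy).
exists f.
  apply/andP; split; last by apply/forallP=> y; rewrite ffunE; case: (y \in H) => /=.
  apply/forall_inP=> y Hy; apply/forall_inP=> z Hz; rewrite !fE ?groupM // /chi.
  by rewrite morphM ?nRH // lin_charM ?Qc.
apply: contra Ki => /eqP/(congr1 (@ssval _ _)); rewrite fE // => ex.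
by rewrite cfkerEirr inE lin_char1 //; apply/eqP.
Qed.

Definition homs H : {set {ffun gT -> fiber}} := [set f | is_hom H f].

Lemma hom_triv H : is_hom H [ffun=> fiber1].
Proof.
apply/andP; split; last by apply/forallP=> x; rewrite ffunE eqxx implybT.
by apply/forall_inP=> x _; apply/forall_inP=> y _; rewrite !ffunE /= mulr1.
Qed.

Definition hmul (f f' : {ffun gT -> fiber}) : {ffun gT -> fiber} :=
  [ffun x => fiberM (f x) (f' x)].

Lemma hom_mul H f f' : is_hom H f -> is_hom H f' -> is_hom H (hmul f f').
Proof.
move=> hf hf'; apply/andP; split.
  apply/forall_inP=> x Hx; apply/forall_inP=> y Hy; rewrite !ffunE /=.
  by rewrite (homM hf) // (homM hf') // mulrACA.
apply/forallP=> x; apply/implyP=> nHx.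
by rewrite ffunE (hom_out hf) // (hom_out hf') // -val_eqE /= mulr1.
Qed.

Lemma hmul_inj f : injective (hmul f).
Proof.
move=> f1 f2 e; apply/ffunP=> x; apply/val_inj/(mulfI (fiber_neq0 (f x))).
by move/ffunP/(_ x)/(congr1 (@ssval _ _)): e; rewrite !ffunE.
Qed.

Lemma homs_orth H x : x \in H ->
  \sum_(f in homs H) ssval (f x) = #|homs H|%:R * (x \in nresidual n H)%:R.
Proof.
move=> Hx; have [Rx | nRx] := boolP (x \in _).
  rewrite mulr1 -sumr_const; apply: eq_bigr => f; rewrite inE => hf.
  by rewrite (hom_nresidual hf).
have [f0 hf0 ne] := hom_sep Hx nRx; rewrite mulr0.
set S := \sum_(f in _) _; have eS : S = ssval (f0 x) * S.
  pose T := [set hmul f0 f | f in homs H].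
  have eT : T = homs H.
    apply/eqP; rewrite eqEcard card_imset ?leqnn ?andbT; last exact: hmul_inj.
    by apply/subsetP=> _ /imsetP[f hf ->]; move: hf; rewrite !inE; apply: hom_mul.
  rewrite {1}/S -eT big_imset /= => [|f f' _ _]; last exact: hmul_inj.
  by rewrite big_distrr; apply: eq_bigr => f _; rewrite ffunE.
apply/eqP; move/eqP: eS; rewrite -subr_eq0 -{1}[S]mul1r -mulrBl mulf_eq0.
by rewrite subr_eq0 eq_sym -[1]/(ssval fiber1) val_eqE (negbTE ne).
Qed.

Definition hsum H h : fburnside :=
  \sum_(f in homs H) (ssval (f h))^-1 *: bclass (H, f).

Definition hsum_count H h K k : algC := (#|H|%:R)^-1 * (#|homs H| *
  #|[set g in G | (K \subset H :^ g^-1)%g && (h^-1 * k ^ g \in nresidual n H)%g]|)%:R.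

Lemma species_hsum H h K k : H \subset G -> h \in H -> k \in K ->
  species K k (hsum H h) = hsum_count H h K k.
Proof.
move=> sH Hh Kk; have nzH : #|H|%:R != 0 :> algC by rewrite pnatr_eq0 -lt0n.
apply: (mulfI nzH); rewrite /hsum_count mulVKf // species_sum big_distrr /=.
transitivity (\sum_(f in homs H) \sum_(g in G) (ssval (f h))^-1 * fixv K k (H, f) g).
  apply: eq_bigr => f; rewrite inE => hf; have Mf : (H, f) \in mpairs by rewrite inE sH.
  by rewrite speciesZ species_bclass // mulrCA (mark_sumE Mf) // big_distrr.
rewrite exchange_big natrM /=.
have -> : #|[set g in G | (K \subset H :^ g^-1)%g && (h^-1 * k ^ g \in nresidual n H)%g]|%:R
    = \sum_(g in G) ((K \subset H :^ g^-1)%g && (h^-1 * k ^ g \in nresidual n H)%g)%:R :> algC.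
  rewrite -sum1dep_card natr_sum big_mkcondr; apply: eq_bigr => g _.
  by case: (_ && _).
rewrite big_distrr; apply: eq_bigr => g Gg; rewrite /fixv /=.
have [sK | _] /= := boolP (K \subset _); last by rewrite mulr0 big1 // => f _; rewrite mulr0.
have Hkg : (k ^ g)%g \in H by rewrite -mem_conjgV (subsetP sK).
have Hx : (h^-1 * k ^ g)%g \in H by rewrite groupM ?groupV.
rewrite -(homs_orth Hx); apply: eq_bigr => f; rewrite inE => hf.
by have -> := homM hf (groupVr Hh) Hkg; rewrite (homV hf).
Qed.

Lemma hsum_count_rat H h K k : hsum_count H h K k \in Crat.
Proof. by rewrite rpredM ?rpredV ?rpred_nat. Qed.

Lemma hsum_count_neq0 H h : h \in H -> hsum_count H h H h != 0.
Proof.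
move=> Hh; rewrite mulf_neq0 ?invr_eq0 ?pnatr_eq0 -?lt0n ?cardG_gt0 //.
rewrite muln_gt0; apply/andP; split; apply/card_gt0P.
  by exists [ffun=> fiber1]; rewrite inE hom_triv.
by exists 1%g; rewrite !inE group1 invg1 conjsg1 subxx conjg1 mulVg group1.
Qed.

Lemma hsum_count_eq0 H h K k : h \in H -> k \in K -> (#|H| <= #|K|)%N ->
  hsum_count H h K k != 0 -> dorbit K k = dorbit H h.
Proof.
move=> Hh Kk leHK; rewrite mulf_eq0 negb_or pnatr_eq0 -lt0n muln_gt0.
case/and3P=> _ _ /card_gt0P[g]; rewrite !inE => /and3P[Gg sK Rk].
have eK : K = (H :^ g^-1)%G by apply/val_inj/eqP; rewrite eqEcard sK cardJg.
apply/eqP/dorbitP; exists g^-1%g; split; rewrite ?groupV //.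
rewrite eK /= nresidualJ conjsMg conjg_set1; apply/lcoset_eqP.
by rewrite mem_lcoset mem_conjgV conjMg conjVg conjgKV.
Qed.

Lemma primitive_idempotent_exists H h : H \subset G -> h \in H ->
  exists e, is_primitive_idempotent H h e.
Proof.
have [m] := ubnP #|H|; elim: m H h => // m IH H h ltHm sH Hh.
pose I := ({group gT} * gT)%type.
pose D : pred I := fun i => (i.1 \subset G) && (i.2 \in i.1).
pose D' : pred I := fun i => D i && (#|i.1| < #|H|)%N.
pose same (i j : I) := dorbit i.1 i.2 == dorbit j.1 j.2.
have /fin_all_exists[E EP] (i : I) : exists e, D' i ==> is_primitive_idempotent i.1 i.2 e.
  have [/andP[/andP[sK Kk] ltK] | _] := boolP (D' i); last by exists 0.
  by apply: IH => //; apply: leq_trans ltK _.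
have spE i K k : D' i -> K \subset G -> k \in K ->
    species K k (E i) = (dorbit K k == dorbit i.1 i.2)%:R.
  move=> Di sK Kk; have := EP i; rewrite Di => /andP[_ /forallP/(_ K)/forallP/(_ k)].
  by rewrite sK Kk => /eqP.
pose w (i : I) := #|[pred j | D j && same j i]|.
pose a i := (w i)%:R^-1 * hsum_count H h i.1 i.2.
pose e' := hsum H h - \sum_(i | D' i) a i *: E i.
pose c := hsum_count H h H h; have nzc : c != 0 by apply: hsum_count_neq0.
have sp' K k : K \subset G -> k \in K ->
    species K k e' = c * (dorbit K k == dorbit H h)%:R.
  move=> sK Kk; rewrite speciesD -scaleN1r speciesZ mulN1r species_hsum // species_sum.
  have [ltK | leH] := ltnP #|K| #|H|.
    have -> : (dorbit K k == dorbit H h) = false.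
      by apply/eqP=> /dorbit_card eK; rewrite eK ltnn in ltK.
    apply/eqP; rewrite mulr0 subr_eq0 eq_sym; apply/eqP.
    have DK : D (K, k) by rewrite /D sK.
    transitivity (\sum_(i | D i && same i (K, k)) (w (K, k))%:R^-1 * hsum_count H h K k).
      rewrite [LHS](bigID (fun i => same i (K, k))) /= [X in _ + X]big1 ?addr0; last first.
        move=> i /andP[Di ns]; rewrite speciesZ spE //.
        by rewrite eq_sym -[_ == _]/(same i (K, k)) (negbTE ns) mulr0.
      apply: eq_big => [i | i /andP[Di /eqP si]].
        rewrite /D' -andbA; congr (_ && _); apply: andb_idl => /eqP si.
        by rewrite (dorbit_card si).
      rewrite speciesZ spE // si eqxx mulr1 /a.
      have /andP[/andP[si1 si2] _] := Di.
      rewrite -!species_hsum // (species_dorbit _ si2 Kk si); congr (_%:R^-1 * _).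
      by apply: eq_card => j; rewrite !inE /same si.
    rewrite sumr_const -[_ *+ _]mulr_natl mulrA mulfV ?mul1r // pnatr_eq0 -lt0n.
    by apply/card_gt0P; exists (K, k); apply/andP; split; rewrite // /same eqxx.
  rewrite [X in _ - X]big1 => [|i Di]; last first.
    rewrite speciesZ spE //; case: eqP => [si|_]; last by rewrite mulr0.
    by case/andP: Di => _; rewrite -(dorbit_card si) ltnNge leH.
  rewrite subr0; case: eqP => [si | nsi].
    by rewrite mulr1 /c -!species_hsum // (species_dorbit _ Kk Hh si).
  by rewrite mulr0; apply/eqP; apply: contra_notT nsi => /(hsum_count_eq0 Hh Kk leH).
exists (c^-1 *: e'); apply/andP; split; last first.
  apply/forallP=> K; apply/forallP=> k; apply/implyP=> /andP[sK Kk].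
  by rewrite speciesZ sp' // mulKf.
apply: fb_ratZ; first by rewrite rpredV hsum_count_rat.
apply: fb_ratD.
  apply: fb_rat_sum => f; rewrite inE => hf; apply: fb_rat_bclass.
  by rewrite -(homV hf) // ssvalP.
rewrite -scaleN1r; apply: fb_ratZ; first by rewrite rpredN rpred1.
apply: fb_rat_sum => i Di; apply: fb_ratZ.
  by rewrite rpredM ?rpredV ?rpred_nat ?hsum_count_rat.
by have := EP i; rewrite Di => /andP[].
Qed.

Definition primitive_idempotent H h (sHG : H \subset G) (Hh : h \in H) : fburnside :=
  xchoose (primitive_idempotent_exists sHG Hh).

Lemma primitive_idempotentP H h (sHG : H \subset G) (Hh : h \in H) :
  is_primitive_idempotent H h (primitive_idempotent sHG Hh).
Proof. exact: xchooseP. Qed.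

Fact conductor_subproof H h (sHG : H \subset G) (Hh : h \in H) :
  exists t, (0 < t)%N && (primitive_idempotent sHG Hh *+ t \in fb_int).
Proof. by apply: fb_rat_denom; case/andP: (primitive_idempotentP sHG Hh). Qed.

Definition conductor H h (sHG : H \subset G) (Hh : h \in H) : nat :=
  ex_minn (conductor_subproof sHG Hh).


End FiberedBurnside.

(* Main.v *)
Require Import Defs.
From mathcomp Require Import all_boot all_order all_algebra.
From mathcomp Require Import all_fingroup all_solvable all_field all_character.
From mathcomp Require Import ring.

Set Implicit Arguments.
Unset Strict Implicit.
Unset Printing Implicit Defensive.

Import Order.TTheory GRing.Theory Num.Theory.
Local Open Scope ring_scope.

(** Write R for the n-residual of H, N for the stabiliser of (H, hR) in G, and T
    for the group of homomorphisms from H to the n-th roots of unity; orthogonality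
    gives #|T| = #|H : R|. The primitive idempotent has the explicit form
    ([primitive_idempotentE])

      e = (#|T| #|N|)^-1 sum_(K <= H) sum_(f in T) #|K| mu(K, H) f(h)^-1 [K, f|K]

    with mu the Moebius function of the subgroup lattice of H: the sum over f
    isolates the coset hR, the sum over K isolates H among its subgroups. It
    remains to find the common denominator of the coefficients.

    Upper bound ([primitive_idempotent_int]). The homomorphisms that agree on K form
    a coset of the annihilator T_K of K in T, and the sum of f(h)^-1 over such a
    coset is 0 or #|T_K| = #|H : KR| times a root of unity. Moreover, pairs that are
    conjugate under H contribute equally. So it suffices that #|'N_H(K) : K| divides
    #|R : H'|_0 #|T_K| mu(K, H), where m_0 denotes the radical of m. By the theorem
    of Hawkes, Isaacs and Ozaydin ([dvdn_mobius]), #|'N_H(K) : K| divides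
    #|H : H'K|_0 mu(K, H), and #|H : H'K| divides #|R : H'| #|T_K|
    ([dvdn_index_annihilator]).

    Lower bound. The coefficient of e at [H, 1] is #|N : R|^-1, so the conductor is
    a multiple of #|N : R|. Let p be a prime divisor of #|R : H'|. The group R / H'
    consists of n-th powers in H / H', so it is killed by exp(G) / n; as this is
    prime to n, p does not divide n. Therefore T_K is trivial for each subgroup K of
    index p of H, and the coefficient of e at [K, 1] is - (m / p) #|N : R|^-1, where
    m counts the G-conjugates of K inside H. The total number of subgroups of index
    p is not divisible by p ([prime_ndvdn_card_index]), so for some K neither is m,
    and the conductor has a further factor p ([prime_index_dstab_dvdn]). *)

(** * Radicals and sums over orbits *)

Lemma radical_dvdP m k :
  reflect (forall p, p \in primes m -> (p %| k)%N) (radical m %| k)%N.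
Proof.
rewrite /radical; have := primes_uniq m.
have: all prime (primes m) by apply/allP=> p; rewrite mem_primes; case/andP.
elim: (primes m) => [|p s IHs] /=; first by rewrite big_nil dvd1n; constructor.
case/andP=> p_pr s_pr /andP[sp us].
rewrite big_cons Gauss_dvd; last first.
  rewrite big_seq; elim/big_ind: _ => [|a b|q sq]; rewrite ?coprimen1 //.
    by rewrite coprimeMr => -> ->.
  rewrite prime_coprime // dvdn_prime2 //; last exact: (allP s_pr).
  by apply: contraNneq sp => ->.
have {IHs}sP := IHs s_pr us; apply: (iffP andP) => [[pk sk] q | sk].
  by rewrite inE => /predU1P[-> // | sq]; apply: (elimT sP).
split; first by apply: sk; rewrite mem_head.
by apply/sP => q sq; apply: sk; rewrite inE sq orbT.
Qed.

Lemma prime_dvd_radical p m : p \in primes m -> (p %| radical m)%N.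
Proof. by move=> mp; move: p mp; apply/radical_dvdP. Qed.

Lemma radicalS m k : (0 < k)%N -> (m %| k)%N -> (radical m %| radical k)%N.
Proof.
move=> k0 mk; apply/radical_dvdP=> p; rewrite mem_primes => /and3P[p_pr _ pm].
by apply: prime_dvd_radical; rewrite mem_primes p_pr k0 (dvdn_trans pm).
Qed.

(** Prime by prime, [p * totient (p ^ k) = p ^ k * (p - 1)] for [k > 0]. *)
Lemma dvdn_radical_totient m : (0 < m)%N -> (m %| radical m * totient m)%N.
Proof.
move=> m0; rewrite totientE // /radical -big_split /=.
rewrite {1}(prod_prime_decomp m0) prime_decompE big_map /=.
apply: (big_ind2 (fun a b => a %| b)%N) => //.
  by move=> a b c d; apply: dvdn_mul.
move=> p _; rewrite mulnCA -expnS dvdn_mull //; by case: (logn p m).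
Qed.

(** The principle behind the integrality of sums over subgroups: an
    invariant function may fail to take its values in [I], as long as the
    length of each orbit clears the denominator. *)
Lemma orbit_sum_closed (aT : finGroupType) (rT : finType) (to : {action aT &-> rT})
    (G : {group aT}) (S : {set rT}) (V : nmodType) (I : {pred V}) (F : rT -> V) :
    addr_closed I -> [acts G, on S | to] -> {in S & G, forall s g, F (to s g) = F s} ->
    {in S, forall s, F s *+ #|orbit to G s| \in I} ->
  \sum_(s in S) F s \in I.
Proof.
move=> [I0 ID] aS FG FI; rewrite (set_partition_big _ (orbit_partition aS)) /=.
elim/big_rec: _ => // _ x /imsetP[s Ss ->] Ix; apply: (ID) Ix.
rewrite (eq_bigr (fun=> F s)) => [|_ /orbitP[g Gg <-]]; last exact: FG.
by rewrite sumr_const FI.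
Qed.

(** * The Moebius function of the subgroup lattice *)

Section Mobius.
Variables (gT : finGroupType) (H : {group gT}).
Implicit Types (K L : {group gT}).

(** [mobius_rec m K] is mu(K, H) as soon as [m] exceeds the length of the chains
    from [K] to [H]; the order of [H] is always enough. *)
Fixpoint mobius_rec m K : int :=
  if m is m'.+1 then
    (K == H)%:R - \sum_(L : {group gT} | (K \proper L) && (L \subset H)) mobius_rec m' L
  else 0.

Definition mobius K : int := mobius_rec #|H| K.

Lemma mobius_rec_stable m m' K : (#|H| < m + #|K|)%N -> (#|H| < m' + #|K|)%N -> K \subset H ->
  mobius_rec m K = mobius_rec m' K.
Proof.
elim: m m' K => [|m IHm] [|m'] K //= ltm ltm' sKH;
  try by move: (subset_leq_card sKH); rewrite leqNgt ?ltm ?ltm'.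
congr (_ - _); apply: eq_bigr => L /andP[/proper_card ltKL sLH].
by apply: IHm => //; [apply: leq_trans ltm _ | apply: leq_trans ltm' _];
  rewrite addSnnS leq_add2l.
Qed.

Lemma mobiusE K : K \subset H -> mobius K =
  (K == H)%:R - \sum_(L : {group gT} | (K \proper L) && (L \subset H)) mobius L.
Proof.
move=> sKH; rewrite /mobius; case eH: #|H| => [|m] /=.
  by have := cardG_gt0 H; rewrite eH.
congr (_ - _); apply: eq_bigr => L /andP[/proper_card ltKL sLH].
have gt1 : (1 < #|L|)%N by apply: leq_ltn_trans ltKL; apply: cardG_gt0.
apply: (mobius_rec_stable (m' := m.+1)) sLH.
  by rewrite eH -addn2 leq_add2l.
by rewrite eH -addn1 leq_add2l cardG_gt0.
Qed.

Lemma mobius_sum K : K \subset H ->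
  \sum_(L : {group gT} | (K \subset L) && (L \subset H)) mobius L = (K == H)%:R.
Proof.
move=> sKH; rewrite (bigD1 K) /= ?subxx // mobiusE // -addrA.
rewrite [X in _ + X](_ : _ = 0) ?addr0 // addrC; apply/eqP; rewrite subr_eq0.
apply/eqP/eq_bigl => L; rewrite properEneq andbAC; congr (_ && _).
by rewrite andbC eq_sym.
Qed.

Lemma mobius_id : mobius H = 1.
Proof.
rewrite mobiusE // eqxx big_pred0 ?subr0 // => L.
by apply/negP=> /andP[/proper_subn/negbTE->].
Qed.

Lemma mobius_maximal K : maximal K H -> mobius K = -1.
Proof.
move=> maxK; have [sKH nHK] := andP (maxgroupp maxK).
rewrite mobiusE // (_ : (K == H) = false); last first.
  by apply: contraNF nHK => /eqP->.
rewrite (big_pred1 H) ?mobius_id ?sub0r // => L /=.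
apply/andP/eqP=> [[pKL sLH] | ->]; last by rewrite (maxgroupp maxK).
apply/val_inj/eqP; rewrite eqEsubset sLH; apply: contraLR pKL => nsHL.
have pLH : L \proper H by rewrite properE sLH.
rewrite properE negb_and negbK; apply/orP; case sKL: (K \subset L); [right|left] => //.
by rewrite ((maxgroupP maxK).2 L pLH sKL).
Qed.

Lemma mobiusJ K x : x \in H -> mobius (K :^ x)%G = mobius K.
Proof.
move=> Hx; rewrite /mobius; elim: #|H| K => //= m IHm K; congr (_ - _).
  congr (_ %:R); congr nat_of_bool; rewrite -(inj_eq val_inj) -[RHS](inj_eq val_inj) /=.
  by rewrite -{1}(conjGid Hx) (can_eq (conjsgK x)).
rewrite (reindex_inj (act_inj 'JG%act x)) /=.
apply: eq_big => [L | L _]; last exact: IHm.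
by rewrite properJ -{1}(conjGid Hx) conjSg.
Qed.

End Mobius.

Section MobiusIndex.
Variables (gT : finGroupType) (H : {group gT}).
Implicit Types (K L : {group gT}).

Lemma card_quotient_preim K (A : {set coset_of K}) : (K <| H)%g -> A \subset (H / K)%g ->
  #|(H :&: coset K @*^-1 A)%g| = (#|K| * #|A|)%N.
Proof.
move=> /andP[sKH nHK] sAQ.
rewrite mulnC -sum_nat_const -sum1_card (partition_big (coset K) [in A]) /=; last first.
  by move=> g /setIP[_ /morphpreP[]].
apply: eq_bigr => q Aq; have /morphimP[x nKx Hx eq] := subsetP sAQ q Aq.
rewrite -(card_rcoset K x) -sum1_card; apply: eq_bigl => g.
apply/andP/idP => [[/setIP[Hg /morphpreP[nKg _]] /eqP] | xKg].
  by rewrite eq => e; apply/rcoset_kercosetP.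
have Hg : g \in H by have /rcosetP[k Kk ->] := xKg; rewrite groupM // (subsetP sKH).
have nKg := subsetP nHK g Hg.
have e : coset K g = q by rewrite eq; apply/rcoset_kercosetP.
by rewrite e inE Hg; split=> //; apply/morphpreP; rewrite /= e.
Qed.

Lemma card_generators_mod K : (K <| H)%g -> cyclic (H / K)%g ->
  #|[set g in H | (K <*> <[g]>)%G == H]| = (#|K| * totient #|H : K|%g)%N.
Proof.
move=> nKH /cyclicP[a defQ]; have [sKH nHK] := andP nKH.
have sgen : [set x | generator <[a]> x] \subset (H / K)%g.
  by apply/subsetP=> x; rewrite inE defQ => /cycle_generator.
have -> : [set g in H | (K <*> <[g]>)%G == H]
    = (H :&: coset K @*^-1 [set x | generator <[a]> x])%g.
  apply/setP=> g; rewrite in_setI [LHS]in_set; case Hg: (g \in H) => //=.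
  have nKg : g \in 'N(K)%g := subsetP nHK g Hg.
  rewrite morphpreE in_setI nKg 2!in_set /= /generator -defQ -quotient_cycle //.
  rewrite -(inj_eq val_inj) /=; apply/eqP/eqP=> [<- | eQ].
    by rewrite quotientYidl ?cycle_subG.
  apply: (quotient_inj (H := K)) => /=; rewrite /normal ?joing_subl ?sKH //.
    by rewrite join_subG normG cycle_subG.
  by rewrite quotientYidl ?cycle_subG.
rewrite -card_quotient // defQ -[#|<[a]>%g|]/(#[a])%g totient_gen.
exact: card_quotient_preim.
Qed.

(** If some [g] normalising [K] generates [H] together with [K], then [K] is
    normal with cyclic quotient of order m, [K] contains [H^`(1)], and the count
    is [#|K| * totient m]. *)
Lemma dvdn_norm_generators_mod K : K \subset H ->
  (#|'N_H(K)%g| %| radical #|H : H^`(1) <*> K|%g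
      * #|[set g in 'N_H(K)%g | (K <*> <[g]>)%G == H]|)%N.
Proof.
move=> sKH; set S := [set g in _ | _].
have [->|[g]] := set_0Vmem S; first by rewrite cards0 muln0.
rewrite inE => /andP[/setIP[Hg nKg] /eqP eH].
have nKH : (K <| H)%g.
  by rewrite /normal sKH -eH join_subG normG cycle_subG.
have cQ : cyclic (H / K)%g.
  apply/cyclicP; exists (coset K g).
  by rewrite -quotient_cycle // -eH /= quotientYidl ?cycle_subG.
have sH'K : (H^`(1) \subset K)%g by rewrite der1_min ?normal_norm ?cyclic_abelian.
rewrite /S {S} (setIidPl (normal_norm nKH)) card_generators_mod //.
rewrite (joing_idPr _) //; rewrite mulnCA -(Lagrange sKH) dvdn_mul //.
by rewrite dvdn_radical_totient.
Qed.

(** The theorem of Hawkes, Isaacs and Ozaydin. Summing the relation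
    sum_(L >= <K, g>) mu(L, H) = [<K, g> = H] over all [g] in ['N_H(K)] gives
    #{g | <K, g> = H} = sum_(L >= K) mu(L, H) #|'N_L(K)|.
    After multiplication by the radical, the left-hand side is a multiple of
    #|'N_H(K)|, and so is, by induction on the index of [K], the contribution of
    each ['N_H(K)]-orbit of groups [L] that properly contain [K]. Hence so is
    the remaining term, for [L = K], which is mu(K, H) #|K|. *)
Theorem dvdn_mobius K : K \subset H ->
  (#|'N_H(K) : K|%g %| (radical #|H : H^`(1) <*> K|%g)%:Z * mobius H K)%Z.
Proof.
have [m] := ubnP (#|H| - #|K|); elim: m K => // m IHm K leKm sKH.
set r := radical _.
pose U L := [&& K \subset L & L \subset H].
have FU L g : g \in 'N_H(K)%g -> U (L :^ g)%G = U L.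
  move=> /setIP[Hg nKg]; rewrite /U /=.
  by rewrite -{1}(normP nKg) -{1}(conjGid Hg) !conjSg.
have sumE : (#|[set g in 'N_H(K)%g | (K <*> <[g]>)%G == H]|)%:Z
    = \sum_(L | U L) mobius H L * (#|'N_L(K)%g|)%:Z.
  transitivity (\sum_(g in 'N_H(K)%g) \sum_(L | U L && (g \in L)) mobius H L); last first.
    rewrite (exchange_big_dep U) /=; last by move=> g L _ /andP[].
    apply: eq_bigr => L /andP[sKL sLH].
    rewrite (eq_bigl [in 'N_L(K)%g]) => [|g]; first by rewrite sumr_const -mulr_natr natz.
    rewrite /U sKL sLH /= [RHS]in_setI [g \in 'N_H(K)%g]in_setI.
    by case Lg: (g \in L); rewrite ?andbF // andbT (subsetP sLH).
  rewrite -[LHS]natz -sum1dep_card natr_sum big_mkcondr; apply: eq_bigr => g /setIP[Hg nKg].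
  rewrite (eq_bigl (fun L : {group gT} =>
      ((K <*> <[g]>)%G \subset L) && (L \subset H))); last first.
    by move=> L; rewrite /U /= join_subG cycle_subG andbAC.
  by rewrite mobius_sum ?join_subG ?sKH ?cycle_subG //; case: eqP.
have dvdA : (#|'N_H(K)%g| %| r%:Z * mobius H K * #|K|%:Z)%Z.
  have -> : r%:Z * mobius H K * #|K|%:Z
     = r%:Z * (#|[set g in 'N_H(K)%g | (K <*> <[g]>)%G == H]|)%:Z
        - \sum_(L in [set L | U L & L != K]) r%:Z * (mobius H L * (#|'N_L(K)%g|)%:Z).
    rewrite sumE (bigD1 K) /=; last by rewrite /U subxx.
    rewrite mulrDr big_distrr /= (setIidPl (normG K)) -mulrA.
    rewrite [X in _ = _ + X - _](eq_bigl [in [set L | U L & L != K]]) ?addrK // => L.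
    by rewrite inE.
  rewrite rpredB //.
    by rewrite -PoszM; apply: dvdn_norm_generators_mod.
  pose F L := r%:Z * (mobius H L * (#|'N_L(K)%g|)%:Z).
  apply: (@orbit_sum_closed _ _ 'JG%act 'N_H(K)%G _ _ (dvdz #|'N_H(K)%g|) F).
  - by split=> [|x y]; [apply: rpred0 | apply: rpredD].
  - apply/actsP=> g Ng L; rewrite ![_ \in [set _ | _]]inE.
    have Kg : (K :^ g)%G = K by apply/val_inj/normP; case/setIP: Ng.
    have -> : ('JG%act L g != K) = (L != K).
      by rewrite -{1}Kg (inj_eq (act_inj 'JG%act g)).
    by rewrite [X in X && _]FU.
  - move=> L g _ Ng; have /setIP[Hg nKg] := Ng.
    by rewrite /F /= mobiusJ // -{1}(normP nKg) normJ -conjIg cardJg.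
  move=> L; rewrite inE => /andP[/andP[sKL sLH] nLK].
  have dvdL : (#|'N_H(L) : L|%g %| r%:Z * mobius H L)%Z.
    have /IHm/(_ sLH) : (#|H| - #|L| < m)%N.
      have ltKL : (#|K| < #|L|)%N by rewrite proper_card // properEneq eq_sym nLK.
      exact: leq_trans (ltn_sub2l (leq_trans ltKL (subset_leq_card sLH)) ltKL) leKm.
    move/dvdz_trans; apply; apply: dvdz_mul => //; apply: radicalS; first exact: indexg_gt0.
    by apply: indexgS; rewrite genS ?setUS.
  (* The orbit of L has #|'N_H(K) : B| elements, so it remains to compare #|B|
     with #|'N_L(K)|; their quotient is the order of a subgroup of 'N_H(L) / L. *)
  pose B := ('N_H(K) :&: 'N(L))%G.
  have sB : 'C_('N_H(K))[L | 'JG]%g = B by rewrite astab1JG.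
  have cB : #|B| = (#|B : L|%g * #|'N_L(K)%g|)%N.
    rewrite mulnC -indexgI -(Lagrange (subsetIl B L)); congr (#|gval _| * _)%N.
    apply/val_inj/setP=> x /=; rewrite !in_setI.
    case Lx: (x \in L); rewrite ?andbF // andbT (subsetP sLH) // (subsetP (normG L)) //.
    by rewrite andbT.
  have dB : (#|B : L|%g %| #|'N_H(L) : L|%g)%N.
    have sBN : B \subset 'N_H(L)%g by rewrite setSI ?subsetIl.
    have sLN : L \subset 'N_H(L)%g by rewrite subsetI sLH normG.
    have eBL : (L <*> B = L * B)%g by rewrite norm_joinEr ?subsetIr.
    have sLB : (L <*> B \subset 'N_H(L))%g by rewrite join_subG sBN sLN.
    by rewrite -(indexMg L B) -eBL -(Lagrange_index sLB) ?dvdn_mull ?joing_subl.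
  have cO := card_orbit_stab 'JG%act 'N_H(K)%G L; rewrite -cO sB cB.
  rewrite -mulr_natl natz !PoszM dvdz_mul // /F mulrA; apply: dvdz_mul => //.
  by apply: dvdz_trans dvdL.
have sKN : K \subset 'N_H(K)%g by rewrite subsetI sKH normG.
move: dvdA; rewrite -(Lagrange sKN) PoszM [X in (X %| _)%Z]mulrC.
by rewrite dvdz_mul2r ?eqz_nat -?lt0n ?cardG_gt0.
Qed.

End MobiusIndex.

(** * Homomorphisms into the roots of unity *)

Lemma sum_indicator (R : pzSemiRingType) (T : finType) (A : {pred T}) (P : pred T) :
  \sum_(x in A) (P x)%:R = #|[set x in A | P x]|%:R :> R.
Proof.
by rewrite -sum1dep_card natr_sum big_mkcondr; apply: eq_bigr => x _; case: (P x).
Qed.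

Section Homs.
Variables (gT : finGroupType) (n : nat) (zeta : algC).
Hypothesis zeta_prim : n.-primitive_root zeta.
Implicit Types (H K : {group gT}) (f psi : {ffun gT -> fiber n zeta}).

Local Notation triv := ([ffun=> fiber1 zeta_prim] : {ffun gT -> fiber n zeta}).
Local Notation homs := (homs zeta_prim).
Local Notation is_hom := (is_hom zeta_prim).

Definition hres K f : {ffun gT -> fiber n zeta} :=
  [ffun x => if x \in K then f x else fiber1 zeta_prim].

Definition annihilator H K : {set {ffun gT -> fiber n zeta}} :=
  [set f in homs H | hres K f == triv].

Lemma hom_hres H K f : K \subset H -> is_hom H f -> is_hom K (hres K f).
Proof.
move=> sKH hf; apply/andP; split; last first.
  by apply/forallP=> x; apply/implyP=> /negbTE nKx; rewrite ffunE nKx.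
apply/forall_inP=> x Kx; apply/forall_inP=> y Ky.
by rewrite !ffunE groupM // Kx Ky (homM hf) // (subsetP sKH).
Qed.

Lemma hres_id H f : is_hom H f -> hres H f = f.
Proof. by move=> hf; apply/ffunP=> x; rewrite ffunE; case: ifPn => // /(hom_out hf). Qed.

Lemma hres_trivP K f : reflect {in K, forall x, ssval (f x) = 1} (hres K f == triv).
Proof.
apply: (iffP eqP) => [e x Kx | f1].
  by have:= congr1 (fun g : {ffun gT -> fiber n zeta} => ssval (g x)) e; rewrite !ffunE Kx.
by apply/ffunP=> x; rewrite !ffunE; case: ifP => // /f1 e; apply/val_inj.
Qed.

Lemma sum_hom H K f : K \subset H -> is_hom H f ->
  \sum_(k in K) ssval (f k) = #|K|%:R * (hres K f == triv)%:R.
Proof.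
move=> sKH hf; rewrite eq_sym -(hom_orth (hom_triv zeta_prim K) (hom_hres sKH hf)).
by apply: eq_bigr => k Kk; rewrite !ffunE Kk /= invr1 mul1r.
Qed.

(** Both sides are the sum of [f k] over all [f] in [homs H] and all [k]
    in [K], computed by orthogonality in one variable or in the other. Given
    [card_homs], this says that the annihilator has order #|H : K R|, with R the
    n-residual of [H]. *)
Lemma card_annihilator H K : K \subset H ->
  (#|annihilator H K| * #|K| = #|homs H| * #|K :&: nresidual n H|)%N.
Proof.
move=> sKH; apply/eqP; rewrite -(eqr_nat algC) !natrM; apply/eqP.
transitivity (\sum_(f in homs H) \sum_(k in K) ssval (f k)).
  rewrite (eq_bigr (fun f => #|K|%:R * (hres K f == triv)%:R)); last first.
    by move=> f; rewrite inE; apply: sum_hom.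
  by rewrite -big_distrr /= mulrC; congr (_ * _); rewrite sum_indicator.
rewrite exchange_big /= (eq_bigr (fun k => #|homs H|%:R * (k \in nresidual n H)%:R)).
  by rewrite -big_distrr /= sum_indicator; congr (_ * _%:R).
by move=> k Kk; rewrite homs_orth // (subsetP sKH).
Qed.

Lemma homs_gt0 H : (0 < #|homs H|)%N.
Proof. by apply/card_gt0P; exists triv; rewrite inE hom_triv. Qed.

Lemma annihilator_self H : annihilator H H = [set triv].
Proof.
apply/setP=> f; rewrite !inE; apply/andP/eqP=> [[/hres_id-> /eqP//] | ->].
by rewrite hom_triv hres_id ?eqxx // hom_triv.
Qed.

Lemma card_homs H : (#|homs H| * #|nresidual n H| = #|H|)%N.
Proof.
have <- : H :&: nresidual n H = nresidual n H by apply/setIidPr/nresidual_sub.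
by rewrite -card_annihilator // annihilator_self cards1 mul1n.
Qed.

Lemma annihilator1 H K : [ffun=> fiber1 zeta_prim] \in annihilator H K.
Proof.
by rewrite inE [_ \in homs H]inE hom_triv; apply/hres_trivP=> x _; rewrite ffunE.
Qed.

Lemma hres_hmul K f f' : hres K (hmul zeta_prim f f') = hmul zeta_prim (hres K f) (hres K f').
Proof.
apply/ffunP=> x; rewrite !ffunE; case: ifP => // _.
by apply/val_inj; rewrite /= mulr1.
Qed.

(** The extensions of [psi] to [H] form a coset of the annihilator of [K], so the
    sum is a root of unity times a character sum over the annihilator, which is
    its order or 0. *)
Lemma sum_hom_extensions H K psi h : h \in H ->
  exists2 z, z \in Cint_span (fiber_seq n zeta) &
    \sum_(f in homs H | hres K f == psi) (ssval (f h))^-1 = #|annihilator H K|%:R * z.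
Proof.
move=> Hh; have [f0 /andP[] | no] :=
  pickP (fun f => (f \in homs H) && (hres K f == psi)); last first.
  by exists 0; [apply: rpred0 | rewrite big_pred0 // mulr0].
rewrite inE => hf0 /eqP <- {psi}.
pose S : algC := \sum_(t in annihilator H K) (ssval (t h))^-1.
(* The extensions of hres K f1 are the products of f1 with the annihilator of
   K; fV is the inverse of f1. *)
have shiftE f1 : f1 \in homs H ->
    \sum_(f in homs H | hres K f == hres K f1) (ssval (f h))^-1 = (ssval (f1 h))^-1 * S.
  rewrite inE => hf1; pose fV : {ffun gT -> fiber n zeta} := finfun (fun x => f1 x^-1%g).
  have hfV : is_hom H fV.
    apply/andP; split; last first.
      by apply/forallP=> x; apply/implyP=> nHx; rewrite ffunE (hom_out hf1) ?groupV.
    apply/forall_inP=> x Hx; apply/forall_inP=> y Hy.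
    by rewrite !ffunE invMg (homM hf1) ?groupV // mulrC.
  have VK f : hmul zeta_prim f1 (hmul zeta_prim fV f) = f.
    apply/ffunP=> x; rewrite !ffunE; apply/val_inj; rewrite /= mulrA.
    have [Hx | nHx] := boolP (x \in H).
      by rewrite (homV hf1) // mulfV ?fiber_neq0 // mul1r.
    by rewrite !(hom_out hf1) ?groupV //= !mul1r.
  rewrite (reindex_onto (hmul zeta_prim f1) (hmul zeta_prim fV)) /= => [|f _]; last exact: VK.
  rewrite big_distrr /=; apply: eq_big => [t | t _]; last by rewrite ffunE /= invfM.
  have Kt : hmul zeta_prim fV (hmul zeta_prim f1 t) = t.
    by apply/(@hmul_inj _ _ _ zeta_prim f1); rewrite VK.
  rewrite Kt eqxx andbT !inE; congr (_ && _).
    by apply/idP/idP=> [hf | ]; [rewrite -Kt; apply: hom_mul | apply: hom_mul].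
  have -> : hres K f1 = hmul zeta_prim (hres K f1) triv.
    by apply/ffunP=> x; rewrite !ffunE; apply/val_inj; rewrite /= mulr1.
  by rewrite hres_hmul (inj_eq (@hmul_inj _ _ _ zeta_prim _)).
rewrite shiftE ?inE //.
have [/forall_inP t1 | /forall_inPn[t Tt t_neq1]] :=
  boolP [forall t in annihilator H K, ssval (t h) == 1].
  exists (ssval (f0 h))^-1.
    by apply: mem_Cint_span; rewrite -(homV hf0) //; apply: ssvalP.
  rewrite /S (eq_bigr (fun=> 1)) => [|t /t1/eqP->]; last by rewrite invr1.
  by rewrite sumr_const mulrC.
have [ht /eqP et] : t \in homs H /\ hres K t == triv by move: Tt; rewrite inE => /andP[].
exists 0; first exact: rpred0.
have eS : S = (ssval (t h))^-1 * S.
  rewrite -shiftE //; apply: eq_bigl => f; rewrite inE et //.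
suff -> : S = 0 by rewrite !mulr0.
apply/eqP; move/eqP: eS; rewrite -subr_eq0 -{1}[S]mul1r -mulrBl mulf_eq0.
by rewrite subr_eq0 eq_sym invr_eq1 (negbTE t_neq1).
Qed.

End Homs.

(** * Subgroups of prime index *)

Section IndexP.
Local Open Scope group_scope.
Variables (gT : finGroupType) (H : {group gT}).
Implicit Types (K L : {group gT}).

(** In the abelian group [H / H^`(1)] the n-th powers already form a subgroup. *)
Lemma nresidual_quotient_powers n a :
  a \in nresidual n H / H^`(1) -> exists2 x, x \in H / H^`(1) & a = x ^+ n.
Proof.
set A := H / _; pose P := [set x ^+ n | x in A].
have cAA : abelian A := der_abelian 0 H.
have gP : group_set P.
  apply/group_setP; split; first by apply/imsetP; exists 1; rewrite ?group1 ?expg1n.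
  move=> _ _ /imsetP[x Ax ->] /imsetP[y Ay ->]; apply/imsetP.
  by exists (x * y); rewrite ?groupM // expgMn //; apply: (centsP cAA).
suff sRP : nresidual n H \subset coset H^`(1) @*^-1 (Group gP).
  case/morphimP=> y nH'y Ry ->; have /morphpreP[_ /imsetP[x Ax ->]] := subsetP sRP y Ry.
  by exists x.
rewrite gen_subG subUset; apply/andP; split; apply/subsetP=> y.
  move=> H'y; have nH'y : y \in 'N(H^`(1)) by apply: (subsetP (normG _)).
  apply/morphpreP; split=> //=; rewrite coset_id //.
  exact: (@group1 _ (Group gP)).
case/imsetP=> x Hx ->; have nH'x : x \in 'N(H^`(1)) := subsetP (der_norm 1 H) x Hx.
apply/morphpreP; split; rewrite ?groupX ?morphX //; apply/imsetP.
by exists (coset H^`(1) x); rewrite ?mem_quotient.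
Qed.

(** An element of order [p] of the quotient is an n-th power, so it is killed by
    [m]. *)
Lemma prime_dvd_index_nresidual n m p : (exponent H %| n * m)%N -> prime p ->
  (p %| #|nresidual n H : H^`(1)|)%N -> (p %| m)%N.
Proof.
move=> eH p_pr; rewrite -card_quotient; last first.
  exact: subset_trans (nresidual_sub n H) (der_norm 1 H).
case/(Cauchy p_pr)=> a /nresidual_quotient_powers[x Ax ->] <-.
rewrite order_dvdn -expgM; case/morphimP: Ax => y nH'y Hy ->.
by rewrite -morphX //= (exponentP eH) // coset_id.
Qed.

(** Modulo its p-residual, [H] has exponent 1 or [p]. Were [H] its own p-residual,
    the p-th power map would be onto the abelian group [H / H^`(1)], hence
    injective, contrary to Cauchy's theorem. *)
Lemma prime_dvd_index_pnresidual p : prime p ->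
  (p %| #|H : H^`(1)|)%N -> (p %| #|H : nresidual p H|)%N.
Proof.
move=> p_pr; rewrite -!card_quotient ?der_norm ?normal_norm ?nresidual_normal // => pA.
have [_ eQ] := nresidual_quotient p H; apply: contraLR pA => npQ; apply/negP=> pA.
have sHR : H \subset nresidual p H.
  rewrite -quotient_sub1 ?normal_norm ?nresidual_normal // subG1 trivg_exponent.
  have /orP[/eqP-> // | /eqP eqp] := (primeP p_pr).2 _ eQ.
  by case/negP: npQ; rewrite -{1}eqp exponent_dvdn.
have [a Aa oa] := Cauchy p_pr pA.
have /imset_injP inj : #|[set x ^+ p | x in H / H^`(1)]| == #|H / H^`(1)|.
  rewrite eqn_leq leq_imset_card subset_leq_card //; apply/subsetP=> b Ab.
  have : b \in nresidual p H / H^`(1) by apply: (subsetP (quotientS _ sHR)).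
  by case/nresidual_quotient_powers=> x Ax ->; apply: imset_f.
have : #[a] = 1%N by rewrite (inj a 1) ?order1 ?group1 // expg1n -oa expg_order.
by rewrite oa => p1; rewrite p1 in p_pr.
Qed.

(** The fibres of [f] on [H] are empty or cosets of the kernel, and there are [p]
    of them, so the index is at most [p]; it is a multiple of [p] since an element
    outside the kernel has order [p] modulo it. *)
Lemma index_hom_kernel p (zp : algC) (zp_prim : p.-primitive_root%R zp) f :
    prime p -> is_hom zp_prim H f -> f != [ffun=> fiber1 zp_prim] ->
  exists K : {group gT}, [/\ K <| H, #|H : K| = p
    & K = [set x in H | f x == fiber1 zp_prim] :> {set gT}].
Proof.
move=> p_pr hf nf; pose K := [set x in H | f x == fiber1 zp_prim].
have gK : group_set K.
  apply/group_setP; split.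
    by rewrite inE group1 -val_eqE /= (hom1 hf) /=.
  move=> y z; rewrite !inE => /andP[Hy /eqP ey] /andP[Hz /eqP ez].
  by rewrite groupM // -val_eqE /= (homM hf) // ey ez /= mulr1.
have nK : Group gK <| H.
  apply/andP; split; first by apply/subsetP=> x; rewrite inE => /andP[].
  apply/subsetP=> y Hy; rewrite inE; apply/subsetP=> _ /imsetP[x Kx ->].
  have /andP[Hx fx] : (x \in H) && (f x == fiber1 zp_prim) by rewrite inE in Kx.
  rewrite inE groupJ //=.
  by rewrite (homJ hf).
exists (Group gK); split=> //.
have [x0 Hx0 nx0] : exists2 x0, x0 \in H & f x0 != fiber1 zp_prim.
  apply/exists_inP; apply: contraR nf => /exists_inPn f1; apply/eqP/ffunP=> x.
  rewrite ffunE; have [Hx | nHx] := boolP (x \in H); last by rewrite (hom_out hf).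
  by apply/eqP; rewrite -[_ == _]negbK f1.
have le_p : (#|H : Group gK| <= p)%N.
  rewrite -(leq_pmul2l (cardG_gt0 (Group gK))) Lagrange ?normal_sub //= -/K.
  rewrite -sum1_card (partition_big f predT) //= mulnC.
  apply: leq_trans (_ : \sum_(z : fiber p zp) #|K| <= _)%N.
    apply: leq_sum => z _; rewrite sum1dep_card.
    have [-> | [x1]] := set_0Vmem [set x in H | f x == z]; first by rewrite cards0.
    rewrite inE => /andP[Hx1 /eqP fx1].
    rewrite -(card_lcoset K x1) subset_leq_card //; apply/subsetP=> x.
    rewrite inE => /andP[Hx /eqP fx]; rewrite mem_lcoset inE groupM ?groupV //= -val_eqE /=.
    by rewrite (homM hf) ?groupV // (homV hf) // fx fx1 mulVf ?fiber_neq0.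
  rewrite sum_nat_const leq_mul2r; apply/orP; right.
  rewrite (_ : #|_| = p) // /fiber card_seq_sub ?size_map ?size_iota //.
  rewrite map_inj_in_uniq ?iota_uniq // => i j; rewrite !mem_iota /= !add0n => ltip ltjp /eqP.
  by rewrite (eq_prim_root_expr zp_prim) !modn_small // => /eqP.
have dvd_p : (p %| #|H : Group gK|)%N.
  have nKx0 := subsetP (normal_norm nK) x0 Hx0.
  rewrite -card_quotient ?normal_norm //.
  have ox : #[coset (Group gK) x0] = p.
    have : (#[coset (Group gK) x0] %| p)%N.
      rewrite order_dvdn -morphX //= coset_id // inE groupX //= -val_eqE /=.
      by rewrite (homX p hf) //; apply/eqP/(mem_fiberP zp_prim)/ssvalP.
    move/((primeP p_pr).2); case/orP=> /eqP // /eqP; rewrite order_eq1 => /eqP e1.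
    by have := coset_idr nKx0 e1; rewrite inE (negbTE nx0) andbF.
  by rewrite -{1}ox order_dvdG // mem_quotient.
by apply/eqP; rewrite eqn_leq le_p dvdn_leq ?indexg_gt0.
Qed.

(** Count the pairs (K, f) with [f : H -> C_p] trivial on [K]: each [K] carries
    [p] such homomorphisms, a nontrivial [f] has a single [K], its kernel, and the
    trivial one has them all. As [p] divides the number of homomorphisms, the
    number of subgroups is 1 modulo [p]. *)
Lemma card_normal_index_prime p : prime p -> (p %| #|H : H^`(1)|)%N ->
  #|[set K : {group gT} | (K <| H) && (#|H : K| == p)]| = 1 %[mod p].
Proof.
move=> p_pr pH; set S := [set K : {group gT} | _].
have [zp zp_prim] := C_prim_root_exists (prime_gt0 p_pr).
pose T := homs zp_prim H; pose t1 : {ffun gT -> fiber p zp} := [ffun=> fiber1 zp_prim].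
have annE K : K \in S -> #|annihilator zp_prim H K| = p.
  rewrite inE => /andP[nKH /eqP iK]; have sKH := normal_sub nKH.
  apply/eqP; rewrite -(eqn_pmul2r (cardG_gt0 K)) card_annihilator //.
  have /setIidPr-> : nresidual p H \subset K.
    have cQ : #|H / K| = p by rewrite card_quotient ?normal_norm.
    apply: nresidual_min => //; last by rewrite -cQ exponent_dvdn.
    by rewrite cyclic_abelian // prime_cyclic // cQ.
  by rewrite card_homs mulnC -iK Lagrange.
have T1 : t1 \in T by rewrite inE hom_triv.
have dcount : (#|S| * p = #|S| + #|T|.-1)%N.
  transitivity (\sum_(K in S) #|annihilator zp_prim H K|)%N.
    by rewrite (eq_bigr (fun=> p)) ?sum_nat_const.
  transitivity (\sum_(K in S) \sum_(f in T | hres zp_prim K f == t1) 1)%N.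
    by apply: eq_bigr => K _; rewrite sum1dep_card.
  rewrite (exchange_big_dep [in T]) /= => [|K f _ /andP[]//].
  rewrite (bigD1 t1) //=; congr (_ + _)%N.
    rewrite -sum1_card; apply: eq_bigl => K.
    by rewrite T1 (hres_id (hom_triv zp_prim K)) eqxx !andbT.
  rewrite [in RHS](cardsD1 t1) T1 /= -sum1_card; apply: eq_big => [f | f /andP[Tf nf]].
    by rewrite in_setD1 andbC.
  have hf : is_hom zp_prim H f by rewrite inE in Tf.
  have [K0 [nK0 iK0 eK0]] := index_hom_kernel p_pr hf nf.
  have inK0 x : (x \in K0) = (x \in H) && (f x == fiber1 zp_prim).
    by have /setP/(_ x) := eK0; rewrite inE.
  rewrite Tf (big_pred1 K0) // => K; rewrite inE.
  apply/andP/eqP => [[/andP[nK /eqP iK] /hres_trivP fK] | ->].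
    apply/val_inj/eqP; rewrite eqEcard; apply/andP; split.
      apply/subsetP=> x Kx; rewrite inK0.
      by rewrite (subsetP (normal_sub nK)) //= -val_eqE /= fK.
    by rewrite -(leq_pmul2r (prime_gt0 p_pr)) -{1}iK0 -iK !Lagrange ?normal_sub.
  rewrite nK0 iK0 eqxx; split=> //; apply/hres_trivP=> x.
  by rewrite inK0 => /andP[_ /eqP->].
have pT : (p %| #|T|)%N.
  rewrite -(dvdn_pmul2r (cardG_gt0 (nresidual_group p H))) card_homs.
  rewrite -(Lagrange (nresidual_sub p H)) mulnC dvdn_pmul2l ?cardG_gt0 //.
  exact: prime_dvd_index_pnresidual.
have T_gt0 : (0 < #|T|)%N by apply/card_gt0P; exists t1.
have : (#|T| + #|S| = #|S| * p + 1)%N by rewrite dcount -addnA addn1 prednK // addnC.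
case/dvdnP: pT => k -> /(congr1 (modn^~ p)).
by rewrite !modnMDl.
Qed.

(** A subgroup of index [p] that is not normal is its own normaliser, so it has
    [p] conjugates: modulo [p], only the normal subgroups count. *)
Lemma prime_ndvdn_card_index p : prime p -> (p %| #|H : H^`(1)|)%N ->
  ~~ (p %| #|[set K : {group gT} | (K \subset H) && (#|H : K| == p)]|)%N.
Proof.
move=> p_pr pH; set U := [set K : {group gT} | _].
pose S := [set K : {group gT} | (K <| H) && (#|H : K| == p)].
have sSU : S \subset U.
  by apply/subsetP=> K; rewrite !inE => /andP[/normal_sub-> ->].
have pNN : (p %| #|U :\: S|)%N.
  rewrite -sum1_card.
  apply: (@orbit_sum_closed _ _ 'JG%act H _ _ [pred m | p %| m]%N (fun=> 1%N)) => //.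
  - by split=> [|x y]; rewrite !inE ?dvdn0 //; apply: dvdn_add.
  - apply/actsP=> y Hy K.
    have sE : (K :^ y \subset H) = (K \subset H) by rewrite -{1}(conjGid Hy) conjSg.
    have iE : #|H : K :^ y| = #|H : K| by rewrite -{1}(conjGid Hy) indexJg.
    have nE : (K :^ y <| H) = (K <| H) by rewrite -{1}(conjGid Hy) normalJ.
    by rewrite !in_setD !in_set /= sE iE nE.
  move=> K; rewrite in_setD !in_set => /andP[nK /andP[sKH iK]].
  rewrite iK andbT /normal sKH /= in nK.
  have eO : #|orbit 'JG H K| = #|H : 'N_H(K)| by rewrite card_orbit astab1JG.
  have sKN : K \subset 'N_H(K) by rewrite subsetI sKH normG.
  have : (#|H : 'N_H(K)| %| p)%N.
    by rewrite -(eqP iK) -(Lagrange_index (subsetIl H 'N(K)) sKN) dvdn_mulr.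
  rewrite inE eO => /((primeP p_pr).2)/orP[|/eqP->]; last by rewrite -mulr_natr mul1r natn.
  by rewrite indexg_eq1 subsetI subxx (negbTE nK).
rewrite -(cardsID S U) (setIidPr sSU) dvdn_addl // /dvdn card_normal_index_prime //.
by rewrite modn_small ?prime_gt1.
Qed.

End IndexP.

(** * The primitive idempotents *)

Definition dstab_group (gT : finGroupType) (G : {group gT}) n (H : {group gT}) h : {group gT} :=
  ('C_G[dpt n H h | dconj_action gT])%G.

Section Conductor.
Variables (gT : finGroupType) (G : {group gT}) (n : nat) (zeta : algC).
Hypothesis zeta_prim : n.-primitive_root zeta.
Variables (H : {group gT}) (h : gT).
Hypotheses (sHG : H \subset G) (Hh : h \in H).
Implicit Types (K L : {group gT}).

Local Notation homs := (homs zeta_prim).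
Local Notation hres := (hres zeta_prim).
Local Notation annihilator := (annihilator zeta_prim H).
Local Notation triv := ([ffun=> fiber1 zeta_prim] : {ffun gT -> fiber n zeta}).
Local Notation bclass := (bclass G zeta_prim).
Local Notation morbit p := (orbit (mconj_action gT n zeta) G p).
Local Notation Zzeta := (Cint_span (fiber_seq n zeta)).
Local Notation Bint := (@fb_int gT G n zeta zeta_prim).
Local Notation R := (nresidual_group n H).
Local Notation N := (dstab_group G n H h).

Lemma hres_mpairs K f : K \subset H -> f \in homs H -> (K, hres K f) \in mpairs G zeta_prim.
Proof. by rewrite !inE => sKH hf; rewrite (subset_trans sKH sHG) (hom_hres sKH hf). Qed.

(** In the ring of [H] itself, #|homs H|^-1 sum_f f(h)^-1 [H, f] has species 1 at
    (K, k) if [k] lies in [h *: R] and 0 otherwise, while Gluck's idempotent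
    #|H|^-1 sum_K #|K| mu(K, H) [K, 1] has species 1 at (K, k) if [K = H] and 0
    otherwise. Up to a scalar, the following element is the product of these two,
    induced to [G]. *)
Definition mobius_combination : fburnside G zeta_prim :=
  \sum_(K : {group gT} | K \subset H) \sum_(f in homs H)
    (#|K|%:R * (mobius H K)%:~R * (ssval (f h))^-1) *: bclass (K, hres K f).

(** The transporter is empty or a coset of the stabiliser. *)
Lemma card_dtransporter L l :
  #|[set x in G | dconj (dpt n L l) x == dpt n H h]|
    = (#|dstab G n H h| * (dorbit G n L l == dorbit G n H h))%N.
Proof.
have [/orbit_eqP/orbitP[a Ga ea] | ne] := eqVneq (dorbit G n L l).
  rewrite muln1 -(card_lcoset (dstab G n H h) a^-1); apply: eq_card => x.
  rewrite in_set mem_lcoset invgK in_setI groupMl //; congr (_ && _).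
  by rewrite -ea -dconjM; apply/eqP/astab1P.
rewrite muln0; apply/eqP; rewrite cards_eq0; apply/eqP/setP=> x; rewrite !inE.
apply: contraNF ne => /andP[Gx /eqP ex]; apply/eqP/orbit_eqP/orbitP.
by exists x^-1%g; rewrite ?groupV //= -ex -dconjM mulgV dconj1.
Qed.

Lemma species_mobius_combination L l : L \subset G -> l \in L ->
  species L l mobius_combination
    = (#|homs H| * #|dstab G n H h| * (dorbit G n L l == dorbit G n H h))%:R.
Proof.
move=> sLG Ll; rewrite species_sum.
transitivity (\sum_(K : {group gT} | K \subset H) \sum_(f in homs H) \sum_(x in G)
    (mobius H K)%:~R * (ssval (f h))^-1 * fixv L l (K, hres K f) x).
  apply: eq_bigr => K sKH; rewrite species_sum; apply: eq_bigr => f Hf.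
  have Mp := hres_mpairs sKH Hf.
  rewrite speciesZ species_bclass // -big_distrr /= -(mark_sumE Mp Ll) /=.
  by rewrite [RHS]mulrCA !mulrA.
under eq_bigr => K _ do rewrite exchange_big /=.
rewrite exchange_big /= -mulnA -card_dtransporter natrM -sum_indicator big_distrr /=.
apply: eq_bigr => x Gx.
transitivity (\sum_(K : {group gT} | ((L :^ x)%G \subset K) && (K \subset H)) (mobius H K)%:~R
    * \sum_(f in homs H) (ssval (f h))^-1 * ssval (f (l ^ x)%g) : algC).
  rewrite big_mkcond [RHS]big_mkcond; apply: eq_bigr => K _.
  rewrite andbC; case: ifP => //= sKH; rewrite big_distrr /=.
  rewrite /fixv /= -sub_conjg; case: ifP => sLK; last by rewrite big1 // => f _; rewrite mulr0.
  apply: eq_bigr => f _; rewrite mulrA ffunE.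
  by rewrite (subsetP sLK) // memJ_conjg.
rewrite -big_distrl /= -rmorph_sum /=.
have [eL | neL] := eqVneq (L :^ x)%G H; last first.
  rewrite (_ : _ == dpt n H h = false) ?mulr0; last first.
    by apply: contraNF neL => /eqP/(congr1 fst)/= ->.
  case sLH: ((L :^ x)%G \subset H); first by rewrite mobius_sum // (negbTE neL) mul0r.
  rewrite big_pred0 ?mul0r // => K; apply: contraFF sLH => /andP[]; exact: subset_trans.
rewrite mobius_sum ?eL ?subxx // eqxx mul1r.
have Hlx : (l ^ x)%g \in H by rewrite -eL memJ_conjg.
transitivity (\sum_(f in homs H) ssval (f (h^-1 * l ^ x)%g)).
  apply: eq_bigr => f; rewrite inE => hf.
  by rewrite [in RHS](homM hf (groupVr Hh) Hlx) (homV hf).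
rewrite (homs_orth _ (groupM (groupVr Hh) Hlx)); congr (_ * (nat_of_bool _)%:R).
have -> : dconj (dpt n L l) x = dpt n H (l ^ x)%g.
  by congr (_, _); rewrite //= conjsMg conjg_set1 -nresidualJ -[(L :^ x)%g]/(gval (L :^ x)%G) eL.
by rewrite -mem_lcoset; apply/lcoset_eqP/eqP=> [e | /(congr1 snd)]; first by congr (_, _).
Qed.

Lemma index_product_gt0 : (0 < #|homs H| * #|N|)%N.
Proof. by rewrite muln_gt0 homs_gt0 cardG_gt0. Qed.

Theorem primitive_idempotentE :
  primitive_idempotent zeta_prim sHG Hh
    = (#|homs H| * #|dstab G n H h|)%:R^-1 *: mobius_combination.
Proof.
apply: species_inj => K k sKG Kk.
have /andP[_ /forallP/(_ K)/forallP/(_ k)] := primitive_idempotentP zeta_prim sHG Hh.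
rewrite sKG Kk speciesZ species_mobius_combination // => /eqP->.
by rewrite [(_ * (_ == _))%:R]natrM mulKf // pnatr_eq0 -lt0n index_product_gt0.
Qed.

Lemma nresidual_sub_dstab : R \subset N.
Proof.
apply/subsetP=> r Rr; have Hr := subsetP (nresidual_sub n H) r Rr.
rewrite inE (subsetP sHG) //=; apply/astab1P; congr (_, _).
  by apply/val_inj; rewrite /= conjGid.
rewrite /= conjsMg conjg_set1.
have nRr : r \in 'N(R)%g := subsetP (normG R) r Rr.
rewrite (normP nRr); apply/lcoset_eqP; rewrite mem_lcoset -commgEl.
rewrite commgEr groupM // memJ_norm ?groupV //.
exact: (subsetP (normal_norm (nresidual_normal n H))).
Qed.

(** * Integrality *)

(** The quotient is #|K :&: R : K :&: H^`(1)|. *)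
Lemma dvdn_index_annihilator K : K \subset H ->
  (#|H : H^`(1) <*> K|%g %| #|R : H^`(1)|%g * #|annihilator K|)%N.
Proof.
move=> sKH; set D := (H^`(1))%G.
have sDR : D \subset R := der_nresidual n H.
have sDH : D \subset H := der_sub 1 H.
have sDK : (D <*> K)%g \subset H by rewrite join_subG sDH.
have nDK : K \subset 'N(D)%g := subset_trans sKH (der_norm 1 H).
have dvdI : (#|D :&: K| %| #|K :&: R|)%N by rewrite setIC cardSg ?setIS.
rewrite -(dvdn_pmul2r (cardG_gt0 K)) -(dvdn_pmul2r (cardG_gt0 D)).
have -> : (#|R : D|%g * #|annihilator K| * #|K| * #|D| = #|H| * #|K :&: R|)%N.
  rewrite -(mulnA #|R : D|%g) card_annihilator // -(card_homs zeta_prim H) /=.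
  by rewrite -(Lagrange sDR) /=; ring.
rewrite -(Lagrange sDK) -mulnA [(#|K| * _)%N]mulnC mul_cardG -norm_joinEr //.
by rewrite mulnA [X in (X * _ %| _)%N]mulnC dvdn_mul.
Qed.

Lemma mconj_hres K f y : K \subset H -> y \in H -> f \in homs H ->
  mconj (K, hres K f) y = ((K :^ y)%G, hres (K :^ y)%G f).
Proof.
rewrite inE => sKH Hy hf; congr (_, _); apply/ffunP=> x; rewrite !ffunE /= mem_conjg.
case: ifP => // Kx; rewrite (homJ hf) ?groupV //.
by rewrite -(conjGid Hy) mem_conjg (subsetP sKH).
Qed.

Lemma dvdn_mobius_annihilator K : K \subset H ->
  (#|'N_H(K) : K|%g %|
     (radical #|R : H^`(1)|%g * #|annihilator K|)%N%:Z * mobius H K)%Z.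
Proof.
move=> sKH; apply: dvdz_trans (dvdn_mobius sKH) _; apply: dvdz_mul => //.
apply/radical_dvdP=> p; rewrite mem_primes => /and3P[p_pr _ pd].
have := dvdn_trans pd (dvdn_index_annihilator sKH); rewrite !Euclid_dvdM //.
case/orP=> pd'; last by rewrite pd' orbT.
by rewrite prime_dvd_radical // mem_primes p_pr indexg_gt0.
Qed.

Lemma mobius_combinationE (o : mclass G zeta_prim) :
  (mobius_combination o : algC) =
    \sum_(K in [set K : {group gT} | K \subset H]) #|K|%:R * (mobius H K)%:~R
      * \sum_(f in homs H | val o == morbit (K, hres K f)) (ssval (f h))^-1.
Proof.
rewrite sum_ffunE; apply: eq_big => [K | K _]; first by rewrite inE.
rewrite sum_ffunE big_distrr /= big_mkcondr; apply: eq_bigr => f _.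
rewrite !ffunE; case: (_ == _); first by rewrite [_ *: _]mulr1.
by rewrite [_ *: _]mulr0.
Qed.

(** The contribution of [K] is a multiple of #|K| mu(K, H) times the order of the
    annihilator of [K], the homomorphisms being grouped by their restrictions to
    [K]; it is the same for the #|H : 'N_H(K)| conjugates of [K] under [H]. *)
Lemma mobius_combination_int (o : mclass G zeta_prim) :
  (radical #|R : H^`(1)|%g)%:R / #|H|%:R * mobius_combination o \in Zzeta.
Proof.
rewrite mobius_combinationE big_distrr /=; set r := radical _.
pose g K : algC := \sum_(f in homs H | val o == morbit (K, hres K f)) (ssval (f h))^-1.
pose F K : algC := r%:R / #|H|%:R * (#|K|%:R * (mobius H K)%:~R * g K).
apply: (@orbit_sum_closed _ _ 'JG%act H _ _ Zzeta F).
- by split=> [|x y]; [apply: rpred0 | apply: rpredD].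
- apply/actsP=> y Hy K; rewrite !inE /=.
  by rewrite -{1}(conjGid Hy) conjSg.
- move=> K y; rewrite inE => sKH Hy; rewrite /F /= mobiusJ // cardJg; congr (_ * (_ * _)).
  apply: eq_bigl => f; apply: andb_id2l; move=> Hf; congr (_ == _).
  apply/orbit_eqP/orbitP.
  by exists y; [apply: (subsetP sHG) | apply: mconj_hres].
move=> K; rewrite inE => sKH.
have [z Zz gE] : exists2 z, z \in Zzeta & g K = #|annihilator K|%:R * z.
  rewrite /g (partition_big (hres K) (fun psi => val o == morbit (K, psi))) /=;
    last by move=> f /andP[].
  apply: (big_ind (fun x => exists2 z, z \in Zzeta & x = #|annihilator K|%:R * z)).
  - by exists 0; rewrite ?mulr0 ?rpred0.
  - move=> _ _ [x Zx ->] [y Zy ->]; exists (x + y); first exact: rpredD.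
    by rewrite mulrDr.
  move=> psi /eqP eo.
  have [z Zz e] := sum_hom_extensions zeta_prim K psi Hh; exists z => //.
  rewrite -e; apply: eq_bigl => f; rewrite -andbA; congr (_ && _).
  by rewrite andbC; apply: andb_idr => /eqP->; apply/eqP.
have /dvdzP[m em] := dvdn_mobius_annihilator sKH.
rewrite -[F K *+ _]mulr_natr /F gE.
have cO : (#|orbit 'JG%act H K| * #|'N_H(K)%g|)%N = #|H|.
  by rewrite -(card_orbit_stab 'JG%act H K) /= astab1JG.
suff -> : r%:R / #|H|%:R * (#|K|%:R * (mobius H K)%:~R * (#|annihilator K|%:R * z))
    * #|orbit 'JG%act H K|%:R = z *~ m by apply: rpredMz.
have nzH : #|H|%:R != 0 :> algC by rewrite pnatr_eq0 -lt0n.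
rewrite -mulrzl; apply: (mulfI nzH).
have em' : r%:R * #|annihilator K|%:R * (mobius H K)%:~R = m%:~R * #|'N_H(K) : K|%g%:R :> algC.
  move/(congr1 (fun i : int => i%:~R : algC)): em.
  by rewrite PoszM !rmorphM /= -!pmulrn.
have cH : #|H|%:R = #|orbit 'JG%act H K|%:R * #|K|%:R * #|'N_H(K) : K|%g%:R :> algC.
  by rewrite -cO -!natrM -mulnA Lagrange // subsetI sKH normG.
transitivity (#|H|%:R / #|H|%:R * (r%:R * #|annihilator K|%:R * (mobius H K)%:~R) * z
    * (#|orbit 'JG%act H K|%:R * #|K|%:R) : algC); first by ring.
by rewrite mulfV // mul1r em' {1}cH; ring.
Qed.

Theorem primitive_idempotent_int :
  primitive_idempotent zeta_prim sHG Hh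
    *+ (#|N : R|%g * radical #|R : H^`(1)|%g) \in Bint.
Proof.
apply/forallP=> o; rewrite ffunMnE primitive_idempotentE ffunE.
set r := radical _; set D := (#|homs H| * #|dstab G n H h|)%N.
suff e : r%:R / #|H|%:R * mobius_combination o
    = (D%:R^-1 * mobius_combination o) *+ (#|N : R|%g * r) :> algC.
  by have := mobius_combination_int o; rewrite e.
have nzD : D%:R != 0 :> algC by rewrite pnatr_eq0 -lt0n index_product_gt0.
have nzH : #|H|%:R != 0 :> algC by rewrite pnatr_eq0 -lt0n.
have eD : (D * r = #|H| * (#|N : R|%g * r))%N.
  by rewrite /D -(Lagrange nresidual_sub_dstab) !mulnA card_homs.
rewrite -[RHS]mulr_natr [RHS]mulrAC; congr (_ * _).
apply: (mulfI nzH); rewrite mulrC divfK //.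
by apply: (mulfI nzD); rewrite [RHS]mulrCA mulVKf // -!natrM eD.
Qed.

(** * Lower bounds for the conductor *)

Lemma exists_mclass p : p \in mpairs G zeta_prim ->
  exists o : mclass G zeta_prim, val o = morbit p.
Proof.
move=> Mp; have Op : morbit p \in morbits G zeta_prim by apply: imset_f.
by exists (Sub (morbit p) Op).
Qed.

Lemma morbit_triv K L f :
  (morbit (K, triv) == morbit (L, hres L f))
    = (orbit 'JG G L == orbit 'JG G K) && (hres L f == triv).
Proof.
apply/eqP/andP=> [/orbit_eqP/orbitP[g Gg e] | [/eqP/orbit_eqP/orbitP[g Gg <-] /eqP->]].
  have eK : K = (L :^ g)%G by have := congr1 fst e.
  split; first by apply/eqP/esym/orbit_eqP/orbitP; exists g.
  apply/eqP/ffunP=> x; have /ffunP/(_ (x ^ g)%g) := congr1 snd e.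
  by rewrite !ffunE conjgK.
apply/esym/orbit_eqP/orbitP; exists g => //=; congr (_, _).
by apply/ffunP=> x; rewrite !ffunE.
Qed.

Lemma mobius_combination_triv K : K \subset H ->
  exists o : mclass G zeta_prim, (mobius_combination o : algC) =
    \sum_(L : {group gT} | (L \subset H) && (orbit 'JG G L == orbit 'JG G K))
      #|L|%:R * (mobius H L)%:~R * \sum_(f in annihilator L) (ssval (f h))^-1.
Proof.
move=> sKH; have [|o eo] := @exists_mclass (K, triv).
  by rewrite inE (subset_trans sKH sHG) hom_triv.
exists o; rewrite mobius_combinationE // big_mkcondr.
apply: eq_big => [L | L _]; first by rewrite inE.
case: ifPn => [eLK | nLK]; last first.
  by rewrite big_pred0 ?mulr0 // => f; rewrite eo morbit_triv (negbTE nLK) andbF.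
congr (_ * _); apply: eq_bigl => f.
by rewrite eo morbit_triv eLK [RHS]inE.
Qed.

Lemma Zzeta_int (x : algC) : x \in Zzeta -> x \in Crat -> x \in Num.int.
Proof.
move=> Zx Qx; apply: Cint_rat_Aint => //.
have /(Cint_spanP (in_tuple (fiber_seq n zeta)))[a ->] := Zx.
apply: rpred_sum => i _; apply: rpredMz; apply: (@Aint_unity_root n).
  exact: prim_order_gt0 zeta_prim.
by apply/unity_rootP/(mem_fiberP zeta_prim)/mem_nth.
Qed.

Lemma sum_annihilator_triv K : annihilator K = [set triv] ->
  \sum_(f in annihilator K) (ssval (f h))^-1 = 1.
Proof. by move->; rewrite big_set1 ffunE /= invr1. Qed.

Lemma dvdn_coef (t : nat) (o : mclass G zeta_prim) (c : int) :
    primitive_idempotent zeta_prim sHG Hh *+ t \in Bint ->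
    (mobius_combination o : algC) = c%:~R ->
  ((#|homs H| * #|N|)%N %| t%:Z * c)%Z.
Proof.
move=> /forallP/(_ o); rewrite ffunMnE primitive_idempotentE ffunE => Zc ec.
have nz : (#|homs H| * #|N|)%:R != 0 :> algC by rewrite pnatr_eq0 -lt0n index_product_gt0.
pose x : algC := t%:R * c%:~R / (#|homs H| * #|N|)%:R.
have {Zc} Zx : x \in Zzeta.
  suff -> : x = ((#|homs H| * #|N|)%:R^-1 * c%:~R) *+ t by rewrite -ec; exact: Zc.
  by rewrite /x -[RHS]mulr_natl [_^-1 * _]mulrC mulrA.
have /intrP[k ek] : x \in Num.int.
  by apply: Zzeta_int => //; rewrite !rpredM ?rpredV ?rpred_nat ?rpred_int.
apply/dvdzP; exists k; apply: (@intr_inj algC).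
rewrite !rmorphM /= -ek -!pmulrn.
by rewrite -natrM /x mulfVK.
Qed.

(** In the sum for the coefficient at [H, 1], only [L = H] and the trivial
    homomorphism remain, so this coefficient of the idempotent is #|N : R|^-1. *)
Lemma index_dstab_dvdn (t : nat) :
    primitive_idempotent zeta_prim sHG Hh *+ t \in Bint ->
  (#|N : R|%g %| t)%N.
Proof.
move=> Zt; have [o] := mobius_combination_triv (subxx H).
rewrite (big_pred1 H) => [|L /=]; last first.
  apply/andP/eqP=> [[sLH /eqP/orbit_eqP/orbitP[g _ eL]] | ->]; last by rewrite subxx eqxx.
  by apply/val_inj/eqP; rewrite eqEcard sLH -eL /= cardJg.
rewrite sum_annihilator_triv ?annihilator_self // mobius_id !mulr1.
move/(dvdn_coef (c := #|H|)) => /(_ t Zt).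
rewrite -PoszM dvdzE /= -(card_homs zeta_prim H) mulnCA dvdn_pmul2l ?homs_gt0 //.
by rewrite -(Lagrange nresidual_sub_dstab) mulnC dvdn_pmul2r.
Qed.

(** The order of the annihilator divides #|homs H|, whose prime divisors divide
    [n], and it divides [p], being the index of [K R] in [H]. *)
Lemma annihilator_index_p K p : prime p -> ~~ (p %| n)%N -> K \subset H ->
  #|H : K|%g = p -> annihilator K = [set triv].
Proof.
move=> p_pr pn sKH iK.
have card_ann := card_annihilator zeta_prim sKH.
have cT := card_homs zeta_prim H.
have sIK : K :&: R \subset K := subsetIl K R.
have sIR : K :&: R \subset R := subsetIr K R.
have pT : ~~ (p %| #|homs H|)%N.
  have -> : #|homs H| = #|H / R|%g.
    apply/eqP; rewrite -(eqn_pmul2r (cardG_gt0 R)) cT card_quotient.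
      by rewrite mulnC Lagrange ?nresidual_sub.
    exact/normal_norm/nresidual_normal.
  apply: contra pn => pQ; have [_] := nresidual_quotient n H.
  apply: dvdn_trans; have [a Qa <-] := Cauchy p_pr pQ.
  exact: dvdn_exponent.
have ann1 : #|annihilator K| = 1%N.
  have dT : (#|annihilator K| %| #|homs H|)%N.
    rewrite -(dvdn_pmul2r (cardG_gt0 (K :&: R)%G)) /= -card_ann dvdn_mul //.
    exact: cardSg.
  have : (#|annihilator K| %| p)%N.
    rewrite -(dvdn_pmul2r (cardG_gt0 R)) -(dvdn_pmul2r (cardG_gt0 K)) mulnAC card_ann.
    rewrite mulnAC cT -(Lagrange sKH) iK [(#|K| * p)%N]mulnC -!mulnA.
    by rewrite [(#|R| * _)%N]mulnC !dvdn_mul // cardSg.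
  case/((primeP p_pr).2 _)/orP=> /eqP // ep.
  by rewrite -ep dT in pT.
apply/eqP; rewrite eq_sym eqEcard ann1 cards1 sub1set andbT.
exact: annihilator1.
Qed.

Lemma mobius_combination_index_p K p : prime p -> ~~ (p %| n)%N -> K \subset H ->
    #|H : K|%g = p ->
  exists o : mclass G zeta_prim, (mobius_combination o : algC) =
    (- (#|K| * #|[set L : {group gT} | [&& L \subset H, #|H : L|%g == p
                     & orbit 'JG G L == orbit 'JG G K]]|)%N%:Z)%:~R.
Proof.
move=> p_pr pn sKH iK; have [o eo] := mobius_combination_triv sKH; exists o.
set M := [set L | _]; rewrite eo.
have cardL L : orbit 'JG G L == orbit 'JG G K -> #|L| = #|K|.
  by move=> /eqP/orbit_eqP/orbitP[g _ <-]; rewrite cardJg.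
have indexL L : L \subset H -> orbit 'JG G L == orbit 'JG G K -> #|H : L|%g = p.
  move=> sLH /cardL cL; apply/eqP; rewrite -(eqn_pmul2l (cardG_gt0 L)) Lagrange //.
  by rewrite cL -iK Lagrange.
transitivity (\sum_(L in M) - #|K|%:R : algC).
  apply: eq_big => [L | L /andP[sLH oL]].
    rewrite inE; case sLH: (L \subset H) => //=.
    by case oL: (_ == _); rewrite ?andbF // indexL ?eqxx.
  have iL := indexL L sLH oL.
  rewrite sum_annihilator_triv ?(annihilator_index_p p_pr) // mobius_maximal.
    by rewrite cardL // mulr1 rmorphN1 mulrN1.
  by apply: p_index_maximal; rewrite ?iL.
by rewrite sumr_const rmorphN /= -pmulrn mulNrn natrM mulr_natr.
Qed.

(** If [t = u * #|N : R|], then [p] divides [u * m] for each [G]-class of subgroups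
    of index [p] of [H], where m is the number of its members. The sum of the m is
    prime to [p], so [p] divides [u]. *)
Lemma prime_index_dstab_dvdn (t p : nat) :
    primitive_idempotent zeta_prim sHG Hh *+ t \in Bint ->
    prime p -> ~~ (p %| n)%N -> (p %| #|R : H^`(1)|%g)%N ->
  (p * #|N : R|%g %| t)%N.
Proof.
move=> Zt p_pr pn pR.
have pH : (p %| #|H : H^`(1)|%g)%N.
  by rewrite -(Lagrange_index (nresidual_sub n H) (der_nresidual n H)) dvdn_mull.
have := prime_ndvdn_card_index p_pr pH; set U := [set K | _] => pU.
have /dvdnP[u et] := index_dstab_dvdn Zt.
rewrite et dvdn_pmul2r ?indexg_gt0 //.
suff : (p %| u * #|U|)%N by rewrite Euclid_dvdM // (negbTE pU) orbF.
rewrite mulnC -sum_nat_const (partition_big (orbit 'JG G) predT) //=.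
apply: dvdn_sum => o _.
have [K /andP[UK /eqP <-{o}] | no] :=
  pickP (fun K => (K \in U) && (orbit 'JG G K == o)); last by rewrite big_pred0.
move: UK; rewrite inE => /andP[sKH /eqP iK].
have [o] := mobius_combination_index_p p_pr pn sKH iK; set M := [set L | _] => eo.
have -> : (\sum_(L in U | orbit 'JG G L == orbit 'JG G K) u = #|M| * u)%N.
  by rewrite -sum_nat_const; apply: eq_bigl => L; rewrite !inE -andbA.
have := dvdn_coef Zt eo; rewrite mulrN -PoszM dvdzE abszN /= et.
rewrite -(Lagrange nresidual_sub_dstab) mulnA card_homs mulnC.
rewrite [X in (_ %| X)%N]mulnAC [X in (_ %| X)%N]mulnC dvdn_pmul2l ?indexg_gt0 //.
rewrite -(Lagrange sKH) iK mulnCA dvdn_pmul2l ?cardG_gt0 //.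
by rewrite mulnC.
Qed.

End Conductor.

(** * The conductor *)

Theorem theorem5p1 (gT : finGroupType) (G : {group gT}) (n : nat)
    (n_dvd : (n %| exponent G)%N)
    (n_coprime : coprime n (exponent G %/ n)%N)
    (zeta : algC) (zeta_prim : n.-primitive_root zeta)
    (H : {group gT}) (h : gT) (sHG : H \subset G) (Hh : h \in H) :
  conductor zeta_prim sHG Hh
    = (#|dstab G n H h : nresidual n H|%g
        * radical #|nresidual n H : H^`(1)|%g)%N.
Proof.
rewrite /conductor; case: ex_minnP => t /andP[t_gt0 Zt] t_min.
set N := dstab G n H h; set r := radical _.
have dvd_t : (#|N : nresidual n H|%g * r %| t)%N.
  have /dvdnP[u et] := index_dstab_dvdn Zt.
  rewrite et mulnC dvdn_pmul2r ?indexg_gt0 //; apply/radical_dvdP=> p.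
  rewrite mem_primes => /and3P[p_pr _ pR].
  have pm : (p %| exponent G %/ n)%N.
    apply: prime_dvd_index_nresidual p_pr pR.
    by rewrite mulnC divnK // exponentS.
  have pn : ~~ (p %| n)%N.
    apply: contraL pm => pn; rewrite -prime_coprime //.
    exact: coprime_dvdl n_coprime.
  have := prime_index_dstab_dvdn Zt p_pr pn pR.
  by rewrite et dvdn_pmul2r ?indexg_gt0.
apply/eqP; rewrite eqn_leq; apply/andP; split; last exact: dvdn_leq.
apply: t_min.
apply/andP; split.
  rewrite muln_gt0 indexg_gt0; apply: (@dvdn_gt0 _ #|nresidual n H : H^`(1)|%g) => //.
  by apply/radical_dvdP=> p; rewrite mem_primes => /and3P[].
exact: primitive_idempotent_int.
Qed.
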